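(* Let $1<p<\infty$, $\lambda_\pm>0$, $0<\gamma<\min\left\{1,\frac{p\alpha_p}{1+\alpha_p}\right\}$, $\tau:=\gamma/(p-\gamma)$, and let $u$ be a local minimizer of $\mathcal{J}$. If $z_\pm\in\Gamma_0\cap\partial\{u_\pm>0\}$ and $\Omega'\Subset\Omega$ is open with $B_r(z_\pm)\subset\Omega'$, then $$\mathcal{L}^N\big(\{0<u_\pm\le C_2r^{1+\tau}\}\cap\Omega'\big)\le C\,r^{(1+\tau)(1-\gamma)},$$ where $C>0$ is independent of $r$ (the statement being understood separately for the sign $+$ and for the sign $-$).
   Context: $\Omega\subset\mathbb{R}^N$ is open and bounded with Lipschitz boundary. The functional is $$\mathcal{J}[u]:=\int_\Omega \frac{|\nabla u|^p}{p}+F_\gamma(u)\,dx,\qquad F_\gamma(u):=\lambda_+(u_+)^\gamma+\lambda_-(u_-)^\gamma,\qquad u_\pm:=\max\{\pm u,0\}.$$ A function $u\in W^{1,p}(\Omega)$ is a local minimizer of $\mathcal{J}$ if $\mathcal{J}[u]\le\mathcal{J}[u+\varphi]$ for every open $\Omega'\Subset\Omega$ and every $\varphi\in W^{1,p}_0(\Omega')$ (extended by zero). Local minimizers belong to $C^{1,\alpha}_{\mathrm{loc}}(\Omega)$ for some $\alpha\in(0,1)$. The free boundary is $\Gamma:=(\partial\{u>0\}\cup\partial\{u<0\})\cap\Omega$ and $\Gamma_0:=\Gamma\cap\{\nabla u=0\}$. $\alpha_p\in(0,1)$ (depending only on $N,p$) denotes the optimal Hölder exponent for the gradient of $p$-harmonic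 functions in $\mathbb{R}^N$. $\mathcal{L}^N$ is Lebesgue measure. $C_2>0$ is the growth constant associated with $u$ and $\Omega'$: for some $0<\rho_0<\operatorname{dist}(\Omega',\partial\Omega)$, $\sup_{B_r(z)}|u|\le C_2r^{1+\tau}$ for all $z\in\Gamma_0\cap\Omega'$ and $0<r<\rho_0$ (it exists for $\gamma$ in the stated range). *)

(* Defs.v *)
From HB Require Import structures.
From mathcomp Require Import all_boot all_order all_algebra.
From mathcomp Require Import all_classical all_reals all_analysis.
Set Implicit Arguments.
Unset Strict Implicit.
Unset Printing Implicit Defensive.
Import Order.TTheory GRing.Theory Num.Theory.
Import numFieldNormedType.Exports.
Local Open Scope classical_set_scope.
Local Open Scope ring_scope.

(* Points of R^N are row vectors ['rV[R]_N]. The norm that MathComp-Analysis   *)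
(* puts on ['rV[R]_N] is the sup norm: only its topology (open, closure,       *)
(* compact, differentiable) is used here; lengths, balls and distances are     *)
(* Euclidean and go through [enorm].                                           *)

Section euclidean.
Context {R : realType} {N : nat}.
Local Notation E := 'rV[R]_N.

Definition edot (x y : E) : R := \sum_i x 0 i * y 0 i.

Definition enorm (x : E) : R := Num.sqrt (edot x x).

Definition eball (z : E) (r : R) : set E := [set x | enorm (x - z) < r].

Definition edist (A B : set E) : \bar R :=
  ereal_inf [set (enorm (z.1 - z.2))%:E | z in A `*` B].

Definition boundary (A : set E) : set E := closure A `\` A°.

Definition compactly_contained (A B : set E) : Prop :=
  compact (closure A) /\ closure A `<=` B.

(* Near every boundary point, and after a choice of the vertical direction nu, *)
(* Omega is the strict epigraph of a Lipschitz function of the orthogonal      *)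
(* projection of x onto the hyperplane nu^\perp. Letting f be defined on all   *)
(* of R^N costs nothing: a Lipschitz function on the hyperplane is extended by *)
(* composition with the projection.                                            *)
Definition lipschitz_boundary (Omega : set E) : Prop :=
  forall z, boundary Omega z ->
  exists (r L : R) (nu : E) (f : E -> R),
    [/\ 0 < r, enorm nu = 1,
        forall x y, `|f x - f y| <= L * enorm (x - y) &
        Omega `&` eball z r =
          [set x | f (x - edot x nu *: nu) < edot x nu] `&` eball z r].

Definition grad (f : E -> R) (x : E) : E :=
  \row_i 'D_(delta_mx 0 i : E) f x.

Definition C1alpha_loc (alpha : R) (U : set E) (f : E -> R) : Prop :=
  (forall x, U x -> differentiable f x) /\
  forall K, compact K -> K `<=` U ->
    exists C : R, forall x y, K x -> K y ->
      enorm (grad f x - grad f y) <= C * enorm (x - y) `^ alpha.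

Definition C1c (U : set E) (phi : E -> R) : Prop :=
  [/\ forall x, differentiable phi x,
      continuous (grad phi),
      compact (closure [set x | phi x != 0]) &
      closure [set x | phi x != 0] `<=` U].

End euclidean.

(* The sigma-algebra generated by the coordinates, i.e. the Borel one.         *)
Definition rV_display : measure_display -> measure_display.
Proof. exact. Qed.

Section measurable_rV.
Context {R : realType} {N : nat}.

Let coor (i : 'I_N) (x : 'rV[R]_N) : R := x 0 i.

Let rV_set0 : g_sigma_preimage coor set0.
Proof. exact: sigma_algebra0. Qed.

Let rV_setC A : g_sigma_preimage coor A -> g_sigma_preimage coor (~` A).
Proof. exact: sigma_algebraC. Qed.

Let rV_bigcup (F : (set 'rV[R]_N)^nat) :
  (forall i, g_sigma_preimage coor (F i)) ->
  g_sigma_preimage coor (\bigcup_i (F i)).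
Proof. exact: sigma_algebra_bigcup. Qed.

HB.instance Definition _ :=
  @isMeasurable.Build (rV_display default_measure_display)
    'rV[R]_N (g_sigma_preimage coor) rV_set0 rV_setC rV_bigcup.

Lemma measurable_coor (i : 'I_N) :
  measurable_fun [set: 'rV[R]_N] (fun x : 'rV[R]_N => x 0 i).
Proof.
move=> _ Y mY; rewrite setTI; apply: sub_sigma_algebra => /=.
rewrite -bigcup_seq/=; exists i => /=; first by rewrite mem_index_enum.
by exists Y => //; rewrite setTI.
Qed.

Lemma measurable_fun_rV d (T : measurableType d) (f : T -> 'rV[R]_N) :
  (forall i, measurable_fun [set: T] (fun t => f t 0 i)) ->
  measurable_fun [set: T] f.
Proof.
move=> mf.
suff h : g_sigma_preimage (fun i => coor i \o f) `<=` measurable.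
  rewrite g_sigma_preimage_comp in h.
  by move=> _ A mA; apply: h; exists A.
apply: smallest_sub; first exact: sigma_algebra_measurable.
rewrite -bigcup_seq; apply: bigcup_sub => i _ A [B mB <-].
exact: mf.
Qed.

End measurable_rV.

Section lebesgue_step.
Context {R : realType} {n : nat}.
Variable m : {sigma_finite_measure set ('rV[R]_n) -> \bar R}.

Definition rV_cons (tx : (measurableTypeR R * 'rV[R]_n)%type) : 'rV[R]_n.+1 :=
  row_mx (tx.1%:M : 'M[R]_1) tx.2.

Definition rV_uncons (x : 'rV[R]_n.+1) : (measurableTypeR R * 'rV[R]_n)%type :=
  (x 0 0, \row_i x 0 (lift 0 i)).

Lemma rV_consK : cancel rV_cons rV_uncons.
Proof.
move=> [t x]; rewrite /rV_uncons /rV_cons /=; congr pair.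
  have -> : (0 : 'I_n.+1) = lshift n (0 : 'I_1) by exact/val_inj.
  by rewrite (@row_mxEl _ 1 1 n) mxE mulr1n.
apply/rowP => i; rewrite mxE.
have -> : (lift 0 i : 'I_n.+1) = rshift 1 i by exact/val_inj.
by rewrite (@row_mxEr _ 1 1 n).
Qed.

Lemma measurable_rV_cons : measurable_fun [set: _] rV_cons.
Proof.
apply: measurable_fun_rV => i.
case: (split_ordP (i : 'I_(1 + n))) => j ij.
- rewrite (_ : (fun _ => _) = fst) //; apply/funext => tx.
  by rewrite /rV_cons ij (@row_mxEl _ 1 1 n) ord1 mxE mulr1n.
- rewrite (_ : (fun _ => _) = (fun x : 'rV[R]_n => x 0 j) \o snd).
    by apply: measurableT_comp => //; exact: measurable_coor.
  by apply/funext => tx; rewrite /rV_cons ij (@row_mxEr _ 1 1 n).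
Qed.

Lemma measurable_rV_uncons : measurable_fun [set: _] rV_uncons.
Proof.
apply/measurable_fun_pairP; split.
  exact: measurable_coor.
apply: measurable_fun_rV => i.
rewrite (_ : (fun _ => _) = (fun x : 'rV[R]_n.+1 => x 0 (lift 0 i))).
  exact: measurable_coor.
by apply/funext => x /=; rewrite mxE.
Qed.

Definition leb_step : set 'rV[R]_n.+1 -> \bar R :=
  pushforward (@lebesgue_measure R \x m)%E rV_cons.

Let leb_step0 : leb_step set0 = 0%E.
Proof. by rewrite /leb_step /pushforward preimage_set0 measure0. Qed.

Let leb_step_ge0 A : (0 <= leb_step A)%E.
Proof. by rewrite /leb_step /pushforward; exact: measure_ge0. Qed.

Let leb_step_sigma_additive : semi_sigma_additive leb_step.
Proof.
move=> F mF tF mUF; rewrite /leb_step /pushforward preimage_bigcup.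
apply: measure_semi_sigma_additive.
- by move=> k; rewrite -[X in measurable X]setTI; exact: measurable_rV_cons.
- apply/trivIsetP => /= i j _ _ ij; rewrite -preimage_setI.
  by move/trivIsetP : tF => /(_ _ _ _ _ ij) ->//; rewrite preimage_set0.
- by rewrite -preimage_bigcup -[X in measurable X]setTI;
    exact: measurable_rV_cons.
Qed.

HB.instance Definition _ := isMeasure.Build _ _ _ leb_step
  leb_step0 leb_step_ge0 leb_step_sigma_additive.

Let leb_step_sigma_finite : sigma_finite setT leb_step.
Proof.
have /sigma_finiteP[F [TF ndF Foo]] := sigma_finiteT (@lebesgue_measure R).
have /sigma_finiteP[G [TG ndG Goo]] := sigma_finiteT m.
exists (fun k => rV_uncons @^-1` (F k `*` G k)).
  rewrite -preimage_bigcup; apply/seteqP; split => // x _ /=.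
  have [i _ Fi] : (\bigcup_i F i) (rV_uncons x).1 by rewrite -TF.
  have [j _ Gj] : (\bigcup_i G i) (rV_uncons x).2 by rewrite -TG.
  exists (maxn i j) => //; split.
    by move: Fi; exact/subsetPset/ndF/leq_maxl.
  by move: Gj; exact/subsetPset/ndG/leq_maxr.
move=> k; have [mF Fk] := Foo k; have [mG Gk] := Goo k.
have mFG : measurable (F k `*` G k) by exact: measurableX.
split; first by rewrite -[X in measurable X]setTI; exact: measurable_rV_uncons.
rewrite /leb_step /pushforward.
rewrite (_ : _ @^-1` _ = F k `*` G k); last first.
  rewrite -comp_preimage (_ : _ \o _ = id) //.
  by apply/funext => x /=; rewrite rV_consK.
by rewrite product_measure1E// lte_mul_pinfty// ge0_fin_numE.
Qed.

HB.instance Definition _ := Measure_isSigmaFinite.Build _ _ _ leb_step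
  leb_step_sigma_finite.

End lebesgue_step.

(* L^N as the N-fold product of the one-dimensional Lebesgue measure.          *)
Fixpoint lebesgue_rV (R : realType) (N : nat) :
    {sigma_finite_measure set ('rV[R]_N) -> \bar R} :=
  match N with
  | 0 => \d_(0 : 'rV[R]_0)
  | n.+1 => leb_step (lebesgue_rV R n)
  end.

Section sobolev.
Context {R : realType} {N : nat}.
Local Notation E := 'rV[R]_N.
Local Notation mu := (lebesgue_rV R N).

Definition loc_integrable (U : set E) (f : E -> R) : Prop :=
  measurable_fun U f /\
  forall K, compact K -> K `<=` U -> mu.-integrable K (EFin \o f).

(* Test functions are C^1 with compact support; by mollification this is the   *)
(* same notion of weak gradient as with C^oo test functions.                   *)
Definition is_weak_gradient (U : set E) (f : E -> R) (g : E -> E) : Prop :=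
  [/\ loc_integrable U f,
      forall i, loc_integrable U (fun x => g x 0 i) &
      forall phi, C1c U phi -> forall i,
        \int[mu]_(x in U) (f x * grad phi x 0 i) =
        - \int[mu]_(x in U) (g x 0 i * phi x)].

Definition weakly_differentiable (U : set E) (f : E -> R) : Prop :=
  exists g, is_weak_gradient U f g.

(* The weak gradient is unique up to a null set; pick one. *)
Definition wgrad (U : set E) (f : E -> R) : E -> E :=
  xget (fun=> 0) [set g | is_weak_gradient U f g].

Definition W1p (p : R) (U : set E) (f : E -> R) : Prop :=
  [/\ weakly_differentiable U f,
      (\int[mu]_(x in U) (`|f x| `^ p)%:E < +oo)%E &
      (\int[mu]_(x in U) (enorm (wgrad U f x) `^ p)%:E < +oo)%E].

Definition W1p_loc (p : R) (U : set E) (f : E -> R) : Prop :=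
  weakly_differentiable U f /\
  forall K, compact K -> K `<=` U ->
    (\int[mu]_(x in K) (`|f x| `^ p)%:E < +oo)%E /\
    (\int[mu]_(x in K) (enorm (wgrad U f x) `^ p)%:E < +oo)%E.

Definition W1p0 (p : R) (U : set E) (f : E -> R) : Prop :=
  W1p p U f /\
  exists phi : nat -> E -> R,
    [/\ forall k, C1c U (phi k),
        (\int[mu]_(x in U) (`|phi k x - f x| `^ p)%:E)%E @[k --> \oo]
          --> 0%E &
        (\int[mu]_(x in U) (enorm (grad (phi k) x - wgrad U f x) `^ p)%:E)%E
          @[k --> \oo] --> 0%E].

(* Weak solutions of div(|grad v|^(p-2) grad v) = 0. For p < 2 the integrand   *)
(* vanishes where the gradient does, since 0 `^ (p - 2) = 0.                   *)
Definition p_harmonic (p : R) (U : set E) (v : E -> R) : Prop :=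
  W1p_loc p U v /\
  forall phi, C1c U phi ->
    \int[mu]_(x in U)
      (enorm (wgrad U v x) `^ (p - 2) * edot (wgrad U v x) (grad phi x)) = 0.

Definition p_harmonic_C1alpha (p a : R) : Prop :=
  forall (U : set E) (v : E -> R), open U -> p_harmonic p U v ->
  exists w : E -> R, C1alpha_loc a U w /\ {ae mu, forall x, U x -> w x = v x}.

End sobolev.

(* Where p-harmonic functions are C^{1,a} for every a < 1 (e.g. p = 2), the    *)
(* supremum is 1.                                                              *)
Definition alpha_p (R : realType) (N : nat) (p : R) : R :=
  sup [set a : R | 0 < a < 1 /\ @p_harmonic_C1alpha R N p a].

Section functional.
Context {R : realType} {N : nat}.
Local Notation E := 'rV[R]_N.
Local Notation mu := (lebesgue_rV R N).

Definition Fgamma (lp lm gamma : R) (s : R) : R :=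
  lp * Num.max s 0 `^ gamma + lm * Num.max (- s) 0 `^ gamma.

Definition J (Omega : set E) (p lp lm gamma : R) (u : E -> R) : \bar R :=
  (\int[mu]_(x in Omega)
     (enorm (wgrad Omega u x) `^ p / p + Fgamma lp lm gamma (u x))%:E)%E.

(* Here u is a function, not a class modulo null sets. Being a local minimizer *)
(* only depends on the class of u, whereas [free_boundary] and [Gamma0] below  *)
(* are the intended sets only for its C^1 representative.                      *)
Definition local_minimizer (Omega : set E) (p lp lm gamma : R) (u : E -> R) :
    Prop :=
  W1p p Omega u /\
  forall Omega' : set E, open Omega' -> compactly_contained Omega' Omega ->
  forall phi : E -> R, W1p0 p Omega' phi ->
    (J Omega p lp lm gamma u <= J Omega p lp lm gamma (u + phi \_ Omega')%R)%E.

(* {x in Omega | w x > 0}; with w = u^\+ this is {u > 0}, with w = u^\- it is  *)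
(* {u < 0}.                                                                    *)
Definition positivity (Omega : set E) (w : E -> R) : set E :=
  Omega `&` [set x | 0 < w x].

Definition free_boundary (Omega : set E) (u : E -> R) : set E :=
  (boundary (positivity Omega u^\+) `|` boundary (positivity Omega u^\-))
    `&` Omega.

Definition Gamma0 (Omega : set E) (u : E -> R) : set E :=
  free_boundary Omega u `&` [set x | grad u x = 0].

Definition growth_constant (Omega : set E) (tau : R) (u : E -> R)
    (Omega' : set E) (C2 : R) : Prop :=
  0 < C2 /\
  exists rho0 : R,
    [/\ 0 < rho0, (rho0%:E < edist Omega' (boundary Omega))%E &
        forall z r, (Gamma0 Omega u `&` Omega') z -> 0 < r < rho0 ->
          (ereal_sup [set `|u x|%:E | x in eball z r]
             <= (C2 * r `^ (1 + tau))%:E)%E].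

End functional.

(* Main.v *)
Require Import Defs.
From mathcomp Require Import all_boot all_order all_algebra.
From mathcomp Require Import all_classical all_reals all_analysis.
From mathcomp Require Import measurable_realfun.
From mathcomp Require Import ring lra.
Import Order.TTheory GRing.Theory Num.Theory.
Import numFieldNormedType.Exports.
Local Open Scope classical_set_scope.
Local Open Scope ring_scope.

(* Testing minimality against [w = u - t eta G(u)], where [eta] is a bump and    *)
(* [G] a nondecreasing C^1 cutoff vanishing on ]-oo, d], with [t] of order [d],  *)
(* convexity of the p-th power bounds the increase of the gradient term by       *)
(* [C t] uniformly in [d], since [grad w = (1 - t eta G'(u)) grad u - t G(u)     *)
(* grad eta] and the first coefficient lies in [0, 1]; concavity of the gamma-th *)
(* power makes the other term decrease by at least                               *)
(* [lambda gamma t u^(gamma - 1) eta G(u)]. Letting [d] tend to 0, the integral  *)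
(* of [u^(gamma - 1)] over [{u > 0}] is locally finite, and on                   *)
(* [{0 < u <= eps}] the integrand is at least [eps^(gamma - 1)]: the set has     *)
(* locally measure at most [C eps^(1 - gamma)], which is the claim for           *)
(* [eps = C2 r^(1 + tau)]. To compute with classical gradients one needs that    *)
(* the weak gradient of a C^1 function is almost everywhere its gradient; this   *)
(* is the integration by parts formula and the fundamental lemma of the calculus *)
(* of variations.                                                                *)

(** * Borel sets and Lebesgue measure of [R^N] *)

(** A minimizer cannot be small and positive on a large set: where [u] is close to 0 the potential
    [lp * u ^ gamma] has the large slope [lp * gamma * u ^ (gamma - 1)], so pushing [u] down gains
    more potential than it costs in gradient energy. Lowering [u] by at most [d / 4] inside a
    compact set, without touching [{u <= d}], costs at most a constant times [d]; on the part of
    [{2 d <= u <= eps}] near a given point it gains at least a constant times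
    [d * eps ^ (gamma - 1)] per unit of measure. By minimality the gain is at most the cost, [d]
    cancels, and [d] tending to 0 leaves a measure of at most [C * eps ^ (1 - gamma)] with [C] free
    of [eps].

    [competitor_le] is this balance at a point: [powR_convex_le] handles the gradient term and
    [powR_bernoulli] the potential. [integral_excess] integrates it, [level_set_local] lets [d] tend
    to 0 near a point, and [level_set_compact] passes to a compact set by a finite cover; here the
    compact set is the closure of [Omega']. The theorem is the case [eps = C2 * r ^ (1 + tau)], and
    the sign minus is the sign plus for [- u] with the two coefficients exchanged
    ([classical_minimizerN]).

    The functional is written with [wgrad], a chosen weak gradient, so computing pointwise requires
    [wgrad_ae]: it equals [grad] almost everywhere. Integration by parts ([integral_partial_eq0],
    Fubini on the recursive measure [lebesgue_rV]) makes [grad] a weak gradient, and the fundamental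
    lemma [loc_integrable_eq0_ae] makes weak gradients unique. [local_minimizer_classical] transfers
    minimality accordingly. *)

Section borel.
Context {R : realType} {N : nat}.
Local Notation E := 'rV[R]_N.

(** A countable base of the topology indexed by [nat]: sup-norm balls with rational centre and
    radius [1 / (k + 1)]. It makes open sets measurable and, in [ae_local], globalizes null sets. *)
Definition rat_ball (n : nat) : set E :=
  if unpickle n is Some (q, k) then ball (map_mx ratr (q : 'rV[rat]_N) : E) (k : nat).+1%:R^-1
  else set0.

Lemma nbhs_rat_ball (x : E) (V : set E) : nbhs x V ->
  exists n, rat_ball n x /\ rat_ball n `<=` V.
Proof.
move=> /nbhs_ballP[e /= e0 eV].
have [k ke] : exists k : nat, k.+1%:R^-1 < e / 2.
  have [//|k] := @ltr_add_invr R 0 (e / 2); first by rewrite divr_gt0.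
  by rewrite add0r; exists k.
have k0 : 0 < k.+1%:R^-1 :> R by rewrite invr_gt0.
have /choice[q hq] : forall j, exists q : rat, `|ratr q - x 0 j| < k.+1%:R^-1.
  move=> j; have [|q] := @rat_in_itvoo R (x 0 j - k.+1%:R^-1) (x 0 j + k.+1%:R^-1).
    by rewrite ltrBlDr -addrA ltrDl addr_gt0.
  by rewrite in_itv/= -ltr_distl => ?; exists q.
exists (pickle (\row_j q j : 'rV[rat]_N, k)); rewrite /rat_ball pickleK; split => [|y].
  by split => // i j; rewrite ord1 !mxE /ball/= hq.
move=> [_ qy]; apply: eV; split=> // i j.
have := qy i j; rewrite ord1 !mxE /ball/= => qyj.
rewrite -(subrK (ratr (q j)) (x 0 j)) -addrA.
rewrite (le_lt_trans (ler_normD _ _))// (splitr e) ltrD//.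
  by rewrite distrC (lt_trans (hq j)).
exact: lt_trans ke.
Qed.

Lemma open_rat_ball (U : set E) : open U ->
  U = \bigcup_(n in [set n | rat_ball n `<=` U]) rat_ball n.
Proof.
move=> oU; apply/seteqP; split => [x Ux|x [i /= iU] /iU//].
have [|n [nx nU]] := nbhs_rat_ball x U; last by exists n.
by move: oU; rewrite openE => /(_ x Ux).
Qed.

Lemma measurable_rat_ball n : measurable (rat_ball n).
Proof.
rewrite /rat_ball; case: unpickle => // -[q k].
rewrite (_ : ball _ _ = \bigcap_(i in [set: 'I_N])
    (fun y : E => y 0 i) @^-1` ball (ratr (q 0 i) : R) k.+1%:R^-1).
  apply: fin_bigcap_measurable => // i _.
  rewrite -[X in measurable X]setTI; apply: measurable_coor => //.
  by apply: open_measurable; apply: ball_open; rewrite invr_gt0.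
apply/seteqP; split => [y [_ qy] i _|y qy]; first by have := qy 0 i; rewrite mxE.
by split => // i j; rewrite ord1 mxE; exact: qy.
Qed.

Lemma open_measurable_rV (U : set E) : open U -> measurable U.
Proof.
move=> /open_rat_ball ->; apply: bigcup_measurable => n _.
exact: measurable_rat_ball.
Qed.

Lemma closed_measurable_rV (U : set E) : closed U -> measurable U.
Proof.
by rewrite -openC => /open_measurable_rV/measurableC; rewrite setCK.
Qed.

Lemma compact_measurable_rV (U : set E) : compact U -> measurable U.
Proof.
move=> cU; apply: closed_measurable_rV.
by apply: compact_closed => //; exact: norm_hausdorff.
Qed.

Lemma continuous_measurable_rV (U : set E) (f : E -> R) : open U ->
  {in U, continuous f} -> measurable_fun U f.
Proof.
move=> oU cf; apply: (measurability _ (RGenOpens.measurableE R)).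
move=> _ [_ [a [b ->] <-]]; apply: open_measurable_rV.
rewrite openE => x [Ux /= fx]; apply: filterI.
  by move: oU; rewrite openE => /(_ x Ux).
have /cf : x \in U by rewrite inE.
by apply; exact: (near_in_itvoo fx).
Qed.

End borel.

(** * Finite measure of bounded sets *)

Section volume.
Context {R : realType}.

Definition cube (N : nat) (M : R) : set 'rV[R]_N :=
  [set x | forall i, `|x 0 i| <= M].

Lemma measurable_cube N M : measurable (cube N M).
Proof.
rewrite (_ : cube N M = \bigcap_(i in [set: 'I_N])
    (fun y : 'rV[R]_N => y 0 i) @^-1` `[- M, M]%classic).
  apply: fin_bigcap_measurable => // i _.
  by rewrite -[X in measurable X]setTI; exact: measurable_coor.
by apply/seteqP; split => x /= xM i => [_|]; have := xM i; rewrite /= in_itv/= -ler_norml//; exact.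
Qed.

(** Induction along [leb_step]: [rV_cons] pulls a cube back to the product of [[- M, M]] and a cube
    of one dimension less. *)
Lemma cube_lty N M : (lebesgue_rV R N (cube N M) < +oo)%E.
Proof.
elim: N => [|N IH]; first by rewrite /= diracE ltry.
rewrite /= /leb_step /pushforward.
rewrite (_ : _ @^-1` _ = `[- M, M]%classic `*` cube N M); last first.
  apply/seteqP; split => [[t x] /= tx|[t x] /= [tM xM] i].
    split.
      have := tx 0; rewrite /rV_cons in_itv/= -ler_norml.
      have -> : (0 : 'I_N.+1) = lshift N (0 : 'I_1) by exact/val_inj.
      by rewrite (@row_mxEl _ 1 1 N) mxE mulr1n.
    move=> i; have := tx (lift 0 i); rewrite /rV_cons.
    have -> : (lift 0 i : 'I_N.+1) = rshift 1 i by exact/val_inj.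
    by rewrite (@row_mxEr _ 1 1 N).
  case: (split_ordP (i : 'I_(1 + N))) => j ->; rewrite /rV_cons/=.
    by rewrite (@row_mxEl _ 1 1 N) ord1 mxE mulr1n ler_norml; move: tM; rewrite in_itv.
  by rewrite (@row_mxEr _ 1 1 N).
rewrite product_measure1E//; last exact: measurable_cube.
have h : (lebesgue_measure `[(- M)%R, M]%classic < +oo :> \bar R)%E.
  by rewrite lebesgue_measure_itv/=; case: ifP => _; rewrite ?ltry// -EFinB ltry.
by rewrite lte_mul_pinfty// ge0_fin_numE.
Qed.

Lemma rV_norm_ge N (x : 'rV[R]_N) i : `|x 0 i| <= `|x|.
Proof. by rewrite [leRHS]/Num.Def.normr/= mx_normrE; exact: (le_bigmax _ _ (0, i)). Qed.

Lemma bounded_set_cube N (A : set 'rV[R]_N) : bounded_set A ->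
  exists2 M, 0 < M & A `<=` cube N M.
Proof.
move=> [M0 [M0r h]]; exists (`|M0| + 1) => [|x Ax i]; first by rewrite ltr_wpDl.
apply: le_trans (rV_norm_ge _ _ _) _; apply: h => //.
by rewrite (le_lt_trans (ler_norm _))// ltrDl.
Qed.

Lemma bounded_set_lty N (A : set 'rV[R]_N) : measurable A -> bounded_set A ->
  (lebesgue_rV R N A < +oo)%E.
Proof.
move=> mA /bounded_set_cube[M _ AM]; apply: le_lt_trans (cube_lty N M).
by apply: le_measure => //; rewrite inE//; exact: measurable_cube.
Qed.

Lemma compact_lty N (A : set 'rV[R]_N) : compact A -> (lebesgue_rV R N A < +oo)%E.
Proof.
move=> cA; apply: bounded_set_lty; first exact: compact_measurable_rV.
exact: compact_bounded.
Qed.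

End volume.

Section integrable_zero_outside.
Context d (T : measurableType d) (R : realType) (mu : {measure set T -> \bar R}).

Lemma bounded_integrableT (A : set T) (g : T -> R) M :
  measurable A -> (mu A < +oo)%E -> measurable_fun [set: T] g ->
  (forall x, A x -> `|g x| <= M) -> (forall x, ~ A x -> g x = 0) ->
  mu.-integrable [set: T] (EFin \o g).
Proof.
move=> mA Aoo mg gM g0.
have -> : EFin \o g = (EFin \o g) \_ A.
  apply/funext => x; rewrite patchE; case: ifPn => // /negP xA.
  by rewrite /= g0// => Ax; apply: xA; rewrite inE.
rewrite -integrable_mkcond//; apply: measurable_bounded_integrable => //.
  exact: measurable_funS mg.
by exists M; split; [exact: num_real|move=> r Mr x Ax; exact: le_trans (gM x Ax) (ltW Mr)].
Qed.

End integrable_zero_outside.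

(** The two difference quotients are the same function of [s]. This identifies the partial
    derivatives of a function on [R^N] with those of its slices. *)
Lemma derive_reparam (R : realType) (V W : normedModType R) (h : W -> R) (f : V -> R)
    (t w : W) (y v : V) : (forall s : R, h (s *: w + t) = f (s *: v + y)) ->
  (derivable f y v -> derivable h t w) /\ 'D_w h t = 'D_v f y.
Proof.
move=> hf; have e : (fun s : R => s^-1 *: ((h \o shift t) (s *: w) - h t)) =
   (fun s : R => s^-1 *: ((f \o shift y) (s *: v) - f y)).
  apply/funext => s /=; rewrite hf; congr (_ *: (_ - _)).
  by have := hf 0; rewrite !scale0r !add0r.
by rewrite /derivable /derive e.
Qed.

(** * Integration by parts *)

Section divergence.
Context {R : realType}.

Lemma rV_cons0 N (t : R) (x : 'rV[R]_N) : rV_cons (t, x) 0 0 = t.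
Proof. exact: (congr1 fst (rV_consK (t, x))). Qed.

Lemma rV_consS N (t : R) (x : 'rV[R]_N) i : rV_cons (t, x) 0 (lift 0 i) = x 0 i.
Proof.
by have /(congr1 snd)/rowP/(_ i) := rV_consK (t, x); rewrite mxE.
Qed.

Lemma rV_cons0E N (s t : R) (x : 'rV[R]_N) :
  rV_cons (s + t, x) = s *: delta_mx 0 0 + rV_cons (t, x).
Proof.
apply/rowP => i; rewrite [RHS]mxE [X in _ = X + _]mxE [X in _ = _ * X + _]mxE.
case: (unliftP 0 i) => [j ->|->].
  by rewrite !rV_consS mulr0 add0r.
by rewrite !rV_cons0 mulr1.
Qed.

Lemma rV_consZ N (s t : R) j (x : 'rV[R]_N) :
  rV_cons (t, s *: delta_mx 0 j + x) = s *: delta_mx 0 (lift 0 j) + rV_cons (t, x).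
Proof.
apply/rowP => i; rewrite [RHS]mxE [X in _ = X + _]mxE [X in _ = _ * X + _]mxE.
case: (unliftP 0 i) => [k ->|->].
  by rewrite !rV_consS !mxE (inj_eq lift_inj).
by rewrite !rV_cons0 mulr0 add0r.
Qed.

Lemma continuous_rV_cons N t : continuous (fun x : 'rV[R]_N => rV_cons (t, x)).
Proof.
move=> x; apply: (proj2 (@cvg_ballP _ _ _ _ (nbhs_filter x) _ _)) => e e0.
apply: (filterS _ (nbhsx_ballx x e e0)) => y xy.
split => // i j; rewrite ord1; case: (unliftP 0 j) => [k ->|->].
  by rewrite !rV_consS; case: xy.
by rewrite !rV_cons0; exact: ballxx.
Qed.

Lemma continuous_rV_consl N (x : 'rV[R]_N) : continuous (fun t : R => rV_cons (t, x)).
Proof.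
move=> t; apply/cvg_ballP => e e0; apply: (filterS _ (nbhsx_ballx t e e0)) => s ts.
split => // i j; rewrite ord1; case: (unliftP 0 j) => [k ->|->].
  by rewrite !rV_consS; exact: ballxx.
by rewrite !rV_cons0.
Qed.

Lemma integral_derive1_eq0 (h : R -> R) (M : R) : 0 < M ->
  (forall t, derivable h t 1) -> continuous ('D_1 h : R -> R) ->
  (forall t, M < `|t| -> h t = 0) ->
  (\int[lebesgue_measure]_t ('D_1 h t)%:E = 0)%E.
Proof.
move=> M0 dh ch h0.
have ch0 : continuous h.
  by move=> t; apply: differentiable_continuous; apply/derivable1_diffP.
have d0 t : M < `|t| -> 'D_1 h t = 0.
  move=> Mt; rewrite (@near_eq_derive _ _ _ _ (cst 0))//.
    exact: derive_cst.
  near=> s; rewrite h0//; near: s.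
  exact: (@norm_continuous _ R t _ (lt_nbhsr Mt)).
(* The interval is enlarged by 1 because [h] is known to vanish only where [M < |t|] strictly; it
   then vanishes at both endpoints. *)
have ab : - (M + 1) < M + 1 :> R by rewrite gtrN// addr_gt0.
have M1 : M < M + 1 by rewrite ltrDl.
rewrite -[RHS](_ : (\int[lebesgue_measure]_(t in `[(- (M + 1))%R, (M + 1)%R])
    ('D_1 h t)%:E = 0)%E); last first.
  rewrite (continuous_FTC2 ab (F := h)).
  - rewrite !h0 ?subee// ?normrN gtr0_norm// ?addr_gt0//.
  - exact: continuous_subspaceT.
  - split; first by move=> t _; exact: dh.
    + exact/cvg_at_right_filter/ch0.
    + exact/cvg_at_left_filter/ch0.
  - by move=> t _; rewrite derive1E.
rewrite [RHS]integral_mkcond; apply: eq_integral => t _; rewrite patchE.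
case: ifPn => // /negP tM; rewrite d0//; rewrite ltNge; apply/negP => tM'.
apply: tM; rewrite inE/= in_itv/= -ler_norml; rewrite (le_trans tM')// ltW//.
Unshelve. all: by end_near. Qed.

Lemma partial_zero_outside N (i : 'I_N) (f : 'rV[R]_N -> R) M x :
  (forall x, ~ cube N M x -> f x = 0) -> ~ cube N M x ->
  'D_(delta_mx 0 i) f x = 0.
Proof.
move=> f0 xM.
have [j Mxj] : exists j, M < `|x 0 j|.
  by apply: contrapT => h; apply: xM => j; rewrite leNgt; apply/negP => h'; apply: h; exists j.
rewrite (@near_eq_derive _ _ _ _ (cst 0)); first exact: derive_cst.
near=> y; apply: f0 => /(_ j); apply/negP; rewrite -ltNge; near: y.
have := @coord_continuous R 1 N 0 j x => cj.
have := @cvgr_norm_gt _ _ _ _ (nbhs_filter x) (fun y : 'rV[R]_N => y 0 j) _ cj M.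
exact.
Unshelve. all: by end_near. Qed.

Lemma compact_cube N M : compact (cube N M : set 'rV[R]_N).
Proof.
rewrite (_ : cube N M = [set x | forall i, `[- M, M]%classic (x 0 i)]); last first.
  by apply/seteqP; split => x /= xM i; have := xM i; rewrite /= in_itv/= -ler_norml.
by apply: (@rV_compact R _ (fun=> `[(- M), M]%classic)) => i; exact: segment_compact.
Qed.

Lemma continuous_compact_bounded N (K : set 'rV[R]_N) (f : 'rV[R]_N -> R) :
  compact K -> {in K, continuous f} -> exists C, forall x, K x -> `|f x| <= C.
Proof.
move=> cK cf; have := @continuous_compact _ _ f K.
have cfK : {within K, continuous f}.
  by apply: continuous_in_subspaceT => x xK; exact: cf.
move=> /(_ cfK cK) /compact_bounded [M [_ h]].
exists (`|M| + 1) => x Kx; apply: (h (`|M| + 1)); last by exists x.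
by rewrite (le_lt_trans (ler_norm _))// ltrDl.
Qed.

(** Fubini for [leb_step], by induction on the dimension. If [i] is the first coordinate, it is
    integrated first and the one-dimensional case applies; otherwise the slices at fixed first
    coordinate fall under the induction hypothesis. *)
Lemma integral_partial_eq0 N (i : 'I_N) (f : 'rV[R]_N -> R) M : 0 < M ->
  (forall x, derivable f x (delta_mx 0 i)) ->
  continuous ('D_(delta_mx 0 i) f : 'rV[R]_N -> R) ->
  (forall x, ~ cube N M x -> f x = 0) ->
  (\int[lebesgue_rV R N]_x ('D_(delta_mx 0 i) f x)%:E = 0)%E.
Proof.
move=> M0; elim: N i f => [[]//|N IH] i f df cf f0.
have [C hC] : exists C, forall x, cube N.+1 M x -> `|'D_(delta_mx 0 i) f x| <= C.
  by apply: continuous_compact_bounded => [|x _]; [exact: compact_cube|exact: cf].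
have d0 x : ~ cube N.+1 M x -> 'D_(delta_mx 0 i) f x = 0.
  exact: partial_zero_outside.
have mD : measurable_fun [set: 'rV[R]_N.+1] ('D_(delta_mx 0 i) f).
  by apply: continuous_measurable_rV => [|x _]; [exact: openT|exact: cf].
have mDc : measurable_fun [set: _] ('D_(delta_mx 0 i) f \o @rV_cons R N).
  by apply: measurableT_comp => //; exact: measurable_rV_cons.
have icons : (@lebesgue_measure R \x lebesgue_rV R N)%E.-integrable [set: _]
    (EFin \o ('D_(delta_mx 0 i) f \o @rV_cons R N)).
  apply: (@bounded_integrableT _ _ _ _ (@rV_cons R N @^-1` cube N.+1 M) _ C) => //.
  - rewrite -[X in measurable X]setTI; apply: measurable_rV_cons => //.
    exact: measurable_cube.
  - exact: (cube_lty N.+1 M).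
  - by move=> x; exact: hC.
  - by move=> x; exact: d0.
rewrite /= /leb_step (integral_pushforward (@measurable_rV_cons R N))//; last first.
  exact/measurable_EFinP.
rewrite preimage_setT.
case: (unliftP 0 i) => [j ij|i0].
- rewrite -integral12_prod_meas1// /fubini_F.
  rewrite (eq_integral (cst 0%E)) ?integral0// => t _ /=.
  have e s x : (f \o (fun x : 'rV[R]_N => rV_cons (t, x))) (s *: delta_mx 0 j + x) =
      f (s *: delta_mx 0 i + rV_cons (t, x)) by rewrite /= rV_consZ ij.
  rewrite -(IH j (f \o (fun x : 'rV[R]_N => rV_cons (t, x)))).
  + by apply: eq_integral => x _; rewrite (derive_reparam _ _ _ _ _ _ _ _ _ (e^~ x)).2.
  + by move=> x; apply: (derive_reparam _ _ _ _ _ _ _ _ _ (e^~ x)).1.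
  + rewrite (_ : 'D__ _ = 'D_(delta_mx 0 i) f \o (fun x : 'rV[R]_N => rV_cons (t, x))).
      move=> x; apply: continuous_comp; first exact: continuous_rV_cons.
      exact: cf.
    by apply/funext => x; rewrite (derive_reparam _ _ _ _ _ _ _ _ _ (e^~ x)).2.
  + move=> x xM; apply: f0 => h; apply: xM => k.
    by have := h (lift 0 k); rewrite rV_consS.
- rewrite -integral21_prod_meas1// /fubini_G.
  rewrite (eq_integral (cst 0%E)) ?integral0// => x _ /=.
  have e s t : (fun t : R => f (rV_cons (t, x))) (s *: (1 : R) + t) =
      f (s *: delta_mx 0 i + rV_cons (t, x)).
    by rewrite /= [_ *: _]mulr1 rV_cons0E i0.
  apply: (etrans _ (@integral_derive1_eq0 (fun t : R => f (rV_cons (t, x))) M M0 _ _ _)).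
  + by apply: eq_integral => t _; rewrite (derive_reparam _ _ _ _ _ _ _ _ _ (e^~ t)).2.
  + by move=> t; apply: (derive_reparam _ _ _ _ _ _ _ _ _ (e^~ t)).1.
  + rewrite (_ : 'D__ _ = 'D_(delta_mx 0 i) f \o (fun t : R => rV_cons (t, x))).
      move=> t; apply: continuous_comp; first exact: continuous_rV_consl.
      exact: cf.
    by apply/funext => t; rewrite (derive_reparam _ _ _ _ _ _ _ _ _ (e^~ t)).2.
  + move=> t tM; apply: f0 => /(_ 0); rewrite rV_cons0 leNgt tM//.
Qed.

End divergence.

(** The increment vanishes near [x], so the zero map satisfies the expansion that characterizes the
    differential. *)
Lemma near0_differentiable (R : numFieldType) (V W : normedModType R) (k : V -> W) (x : V) :
  (\forall y \near x, k y = 0) -> differentiable k x.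
Proof.
move=> k0.
have kx : k x = 0 by exact: nbhs_singleton k0.
have e : k \o shift x = cst (k x) + (\0 : {linear V -> W}) +o_ 0 id.
  apply/eqaddoP => _/posnumP[eps]; rewrite kx; near=> h.
  rewrite /= !fctE/= /cst addr0 subr0 (_ : k (h + x) = 0) ?normr0 ?mulr_ge0//.
  by near: h; move: k0; rewrite (near_shift 0 x) subr0.
have c0 : continuous (\0 : V -> W) by exact: cst_continuous.
have d := @diff_unique _ V W k (\0 : {linear V -> W}) x c0 e.
by apply/diff_locallyP; rewrite d.
Unshelve. all: by end_near. Qed.

Lemma near_eq_differentiable (R : numFieldType) (V W : normedModType R) (f g : V -> W) (x : V) :
  (\forall y \near x, f y = g y) -> differentiable f x -> differentiable g x.
Proof.
move=> fg df; rewrite (_ : g = f + (g - f)); last by rewrite addrC subrK.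
apply: differentiableD => //; apply: near0_differentiable.
by near=> y; rewrite !fctE; apply/eqP; rewrite subr_eq0; apply/eqP; near: y; apply: filterS fg.
Unshelve. all: by end_near. Qed.

(** * Functions of class C^1 *)

Section C1.
Context {R : realType} {N : nat}.
Local Notation E := 'rV[R]_N.
Implicit Types (f g : E -> R) (x : E).

Lemma continuous_rV (T : topologicalType) (f : T -> E) (t : T) :
  (forall i, {for t, continuous (fun s => f s 0 i)}) -> {for t, continuous f}.
Proof.
move=> cf; apply: (proj2 (@cvg_ballP _ _ _ _ (nbhs_filter t) _ _)) => e e0.
have : \forall s \near t, forall i, ball (f t 0 i) e (f s 0 i).
  apply: filter_forall => i.
  exact: (proj1 (@cvg_ballP _ _ _ _ (nbhs_filter t) _ _) (cf i) e e0).
by apply: filterS => s h; split => // i j; rewrite ord1.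
Qed.

Lemma continuous_coord (T : topologicalType) (f : T -> E) (t : T) i :
  {for t, continuous f} -> {for t, continuous (fun s => f s 0 i)}.
Proof.
move=> cf; apply: (@continuous_comp T E R f (fun y => y 0 i)) => //.
exact: coord_continuous.
Qed.

(** A pointwise form of C^1, local and stable under sums, products and compositions; it lets a
    function that is C^1 only on an open set be multiplied by test functions. *)
Definition C1at f x :=
  (\forall y \near x, differentiable f y) /\ {for x, continuous (grad f)}.

Lemma gradE f x i : grad f x 0 i = 'D_(delta_mx 0 i) f x.
Proof. by rewrite mxE. Qed.

Lemma near_eq_grad f g x : (\forall y \near x, f y = g y) -> grad f x = grad g x.
Proof. by move=> fg; apply/rowP => i; rewrite !mxE; exact: near_eq_derive. Qed.

Lemma near_eq_C1at f g x : (\forall y \near x, f y = g y) -> C1at f x -> C1at g x.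
Proof.
move=> fg [df cf]; split.
  move/near_join : fg; apply: filterS2 df => y dfy fgy.
  exact: near_eq_differentiable fgy dfy.
have gfg : {near x, grad f =1 grad g}.
  by move/near_join : fg; apply: filterS => y; exact: near_eq_grad.
rewrite /prop_for /continuous_at -(nbhs_singleton gfg).
exact: cvg_trans (near_eq_cvg gfg) cf.
Qed.

Lemma C1at_differentiable f x : C1at f x -> differentiable f x.
Proof. by case=> /nbhs_singleton. Qed.

Lemma C1at_continuous f x : C1at f x -> {for x, continuous f}.
Proof. by move=> /C1at_differentiable; exact: differentiable_continuous. Qed.

Lemma gradD f g x : differentiable f x -> differentiable g x ->
  grad (f + g) x = grad f x + grad g x.
Proof.
by move=> df dg; apply/rowP => i; rewrite !mxE deriveD//; exact: diff_derivable.
Qed.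

Lemma gradM f g x : differentiable f x -> differentiable g x ->
  grad (f * g) x = f x *: grad g x + g x *: grad f x.
Proof.
by move=> df dg; apply/rowP => i; rewrite !mxE deriveM//; exact: diff_derivable.
Qed.

Lemma grad_comp (h h' : R -> R) f x : (forall s : R, is_derive s (1 : R) h (h' s)) ->
  differentiable f x ->
  differentiable (h \o f) x /\ grad (h \o f) x = h' (f x) *: grad f x.
Proof.
move=> dh df; have dhf : differentiable h (f x) by apply/derivable1_diffP; case: (dh (f x)).
have dc := differentiable_comp df dhf; split => //; apply/rowP => i.
rewrite !mxE !deriveE// diff_comp//= diff1E//= derive1E mulrC.
by congr (_ * _); case: (dh (f x)).
Qed.

Lemma nbhs_forall (P : E -> Prop) x : (forall y, P y) -> \forall y \near x, P y.
Proof. by move=> h; apply: (@filterS _ _ (nbhs_filter x) setT) => //; exact: filterT. Qed.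

Lemma C1at_cst c x : C1at (cst c) x.
Proof.
split; first by apply: nbhs_forall => y; exact: differentiable_cst.
rewrite (_ : grad _ = cst 0); first exact: (@cst_continuous E E 0 x).
by apply/funext => y; apply/rowP => i; rewrite !mxE derive_cst.
Qed.

(** Reduces stability of C^1 under an operation to a formula for the gradient and the continuity of
    that formula. *)
Lemma C1at_near_grad f (F : E -> E) x : (\forall y \near x, differentiable f y) ->
  (\forall y \near x, grad f y = F y) -> {for x, continuous F} -> C1at f x.
Proof.
move=> df fF cF; split => //.
have Ff : {near x, F =1 grad f} by apply: filterS fF => y ->.
rewrite /prop_for /continuous_at (nbhs_singleton fF).
exact: cvg_trans (near_eq_cvg Ff) cF.
Qed.

Lemma C1atD f g x : C1at f x -> C1at g x -> C1at (f + g) x.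
Proof.
move=> [df cf] [dg cg]; apply: (C1at_near_grad _ (grad f + grad g)).
- by apply: filterS2 df dg => y; exact: differentiableD.
- by apply: filterS2 df dg => y; exact: gradD.
- apply: continuous_rV => i.
  rewrite (_ : (fun _ => _) = (fun y => grad f y 0 i) + (fun y => grad g y 0 i)).
    exact: (@continuousD R R E _ _ x (continuous_coord _ _ _ i cf) (continuous_coord _ _ _ i cg)).
  by apply/funext => y; rewrite mxE.
Qed.

Lemma C1atM f g x : C1at f x -> C1at g x -> C1at (f * g) x.
Proof.
move=> Cf Cg; have [df cf] := Cf; have [dg cg] := Cg.
apply: (C1at_near_grad _ (fun y => f y *: grad g y + g y *: grad f y)).
- by apply: filterS2 df dg => y; exact: differentiableM.
- by apply: filterS2 df dg => y; exact: gradM.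
- apply: continuous_rV => i.
  rewrite (_ : (fun _ => _) = f * (fun y => grad g y 0 i) + g * (fun y => grad f y 0 i)).
    have c1 := @continuousM R E _ _ x (C1at_continuous _ _ Cf) (continuous_coord _ _ _ i cg).
    have c2 := @continuousM R E _ _ x (C1at_continuous _ _ Cg) (continuous_coord _ _ _ i cf).
    exact: (@continuousD R R E _ _ x c1 c2).
  by apply/funext => y; rewrite !fctE !mxE.
Qed.

Lemma C1at_comp (h h' : R -> R) f x : (forall s : R, is_derive s (1 : R) h (h' s)) ->
  continuous h' -> C1at f x -> C1at (h \o f) x.
Proof.
move=> dh ch' Cf; have [df cf] := Cf.
apply: (C1at_near_grad _ (fun y => h' (f y) *: grad f y)).
- by apply: filterS df => y dfy; have [] := grad_comp h h' f y dh dfy.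
- by apply: filterS df => y dfy; have [] := grad_comp h h' f y dh dfy.
- apply: continuous_rV => i.
  rewrite (_ : (fun _ => _) = (h' \o f) * (fun y => grad f y 0 i)).
    have c1 := @continuous_comp E R R f h' x (C1at_continuous _ _ Cf) (ch' (f x)).
    exact: (@continuousM R E _ _ x c1 (continuous_coord _ _ _ i cf)).
  by apply/funext => y; rewrite mxE.
Qed.

Lemma C1at_coord i x : C1at (fun y : E => y 0 i) x.
Proof.
apply: (C1at_near_grad _ (cst (delta_mx 0 i))).
- by apply: nbhs_forall => y; exact: differentiable_coord.
- apply: nbhs_forall => y; apply/rowP => j; rewrite gradE.
  (* The derivative of a coordinate is read off that of the identity, taken entrywise. *)
  have /matrixP/(_ 0 i) := @derive_mx _ _ _ _ (@id E) y (delta_mx 0 j) (@derivable_id _ _ _ _).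
  by rewrite derive_id [RHS]mxE => <-; rewrite !mxE eq_sym.
- exact: (@cst_continuous E E _ x).
Qed.

Lemma C1at_sum (I : Type) (r : seq I) (F : I -> E -> R) x :
  (forall i, C1at (F i) x) -> C1at (\sum_(i <- r) F i) x.
Proof.
move=> CF; apply: (big_ind (fun g => C1at g x)); first exact: (C1at_cst 0 x).
  by move=> f g; exact: C1atD.
by move=> i _; exact: CF.
Qed.

Lemma C1atN f x : C1at f x -> C1at (- f) x.
Proof.
move=> Cf; rewrite (_ : - f = cst (-1) * f); first exact: (C1atM (cst (-1)) f x (C1at_cst _ _) Cf).
by apply/funext => y; rewrite !fctE /= mulN1r.
Qed.

End C1.

(** * Piecewise quadratic C^1 cutoffs *)

Section cutoff.
Context {R : realType}.

(** The difference quotient is within [C |h|] of [l]. For piecewise quadratic functions this reduces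
    differentiability, junctions included, to polynomial inequalities. *)
Lemma quadratic_is_derive (f : R -> R) (x l C : R) : 0 < C ->
  (forall h, `|f (h + x) - f x - h * l| <= C * h ^+ 2) -> is_derive x (1 : R) f l.
Proof.
move=> C0 hf.
suff cvg : (fun h : R => h^-1 *: ((f \o shift x) (h *: (1 : R)) - f x)) @ 0^' --> l.
  by apply: DeriveDef; [exact: cvgP cvg|apply: cvg_lim cvg => //; exact: norm_hausdorff].
apply/cvgrPdist_le => e e0; near=> h.
have h0 : h != 0 by near: h; exact: nbhs_dnbhs_neq.
have he : `|h| < e / C by near: h; apply: dnbhs0_lt; rewrite divr_gt0.
rewrite /= [h *: _]mulr1 distrC.
have -> : h^-1 *: (f (h + x) - f x) - l = h^-1 * (f (h + x) - f x - h * l).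
  by rewrite [_ *: _]/(_ * _) [RHS]mulrBr (mulrA h^-1 h) mulVf// mul1r.
rewrite normrM normfV ler_pdivrMl ?normr_gt0//.
apply: le_trans (hf h) _; rewrite -real_normK ?num_real// expr2 mulrA mulrC.
by rewrite ler_wpM2l// mulrC -ler_pdivlMr// ltW.
Unshelve. all: by end_near. Qed.

Definition sqpos (s : R) : R := Num.max 0 s ^+ 2.

Lemma is_derive_sqpos (s : R) : is_derive s (1 : R) sqpos (2 * Num.max 0 s).
Proof.
apply: (@quadratic_is_derive _ _ _ 1) => // h; rewrite /sqpos !maxEle.
case: (leP 0 s) => s0; case: (leP 0 (h + s)) => hs0; rewrite ler_norml; nra.
Qed.

Lemma continuous_sqpos' : continuous (fun s : R => 2 * Num.max 0 s).
Proof.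
move=> s; apply: (@continuousM R R (cst 2) (fun s => Num.max 0 s)).
  exact: cst_continuous.
apply: (@continuous_max R R (cst 0) id); [exact: cst_continuous|exact: cvg_id].
Qed.

Lemma sqpos_ge0 s : 0 <= sqpos s. Proof. exact: sqr_ge0. Qed.

Lemma sqpos_gt0 s : (0 < sqpos s) = (0 < s).
Proof.
rewrite /sqpos maxEle; case: (leP 0 s) => [|s0]; last by rewrite expr0n ltxx lt_gtF.
by rewrite le_eqVlt => /predU1P[<-|s0]; rewrite ?expr0n ?ltxx// exprn_gt0.
Qed.

(** Grows from 0 at 0 to 1 at 1, where it joins the constant 1 in a C^1 way; it serves at
    nonnegative arguments, where its values lie in [[0, 1]]. *)
Definition ramp (s : R) : R := 1 - sqpos (1 - s).

Lemma is_derive_ramp (s : R) : is_derive s (1 : R) ramp (2 * Num.max 0 (1 - s)).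
Proof.
apply: (@quadratic_is_derive _ _ _ 1) => // h; rewrite /ramp /sqpos !maxEle.
case: (leP 0 (1 - s)) => s0; case: (leP 0 (1 - (h + s))) => hs0; rewrite ler_norml; nra.
Qed.

Lemma continuous_ramp' : continuous (fun s : R => 2 * Num.max 0 (1 - s)).
Proof.
move=> s; apply: (@continuous_comp R R R (fun s => 1 - s) (fun s => 2 * Num.max 0 s)).
  by apply: (@continuousB R R R (cst 1) id); [exact: cst_continuous|exact: cvg_id].
exact: continuous_sqpos'.
Qed.

Lemma ramp_le1 s : ramp s <= 1.
Proof. by rewrite /ramp gerBl sqpos_ge0. Qed.

Lemma ramp0 : ramp 0 = 0.
Proof. by rewrite /ramp /sqpos subr0 maxEle ler01 expr1n subrr. Qed.

Lemma ramp_ge0 s : 0 <= s -> 0 <= ramp s.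
Proof. by rewrite /ramp /sqpos maxEle => s0; case: (leP 0 (1 - s)) => ?; nra. Qed.

Lemma ramp_eq1 s : 1 <= s -> ramp s = 1.
Proof.
move=> s1; rewrite /ramp /sqpos maxEle; case: (leP 0 (1 - s)) => h; last by rewrite expr0n subr0.
have -> : 1 - s = 0 by lra.
by rewrite expr0n subr0.
Qed.

(** The inner [sqpos] smooths the junction with 0 at [s = d], and [ramp] the junction with 1 at
    [s = 2 d]. *)
Definition cutoff (d s : R) : R := ramp (sqpos (s / d - 1)).

Definition cutoff' (d s : R) : R :=
  (2 * Num.max 0 (1 - sqpos (s / d - 1))) * ((2 * Num.max 0 (s / d - 1)) * d^-1).

Lemma is_derive_cutoff d s : is_derive s (1 : R) (cutoff d) (cutoff' d s).
Proof.
have d1 : is_derive s (1 : R) (fun t : R => t / d - 1) d^-1.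
  apply: (@quadratic_is_derive _ _ _ 1) => // h.
  have -> : (h + s) / d - 1 - (s / d - 1) - h * d^-1 = 0 by ring.
  by rewrite normr0 mulr_ge0 ?sqr_ge0.
have d2 := is_derive1_comp (g := fun t : R => t / d - 1) (is_derive_sqpos (s / d - 1)) d1.
have d3 := is_derive1_comp (g := sqpos \o (fun t : R => t / d - 1))
  (is_derive_ramp (sqpos (s / d - 1))) d2.
exact: d3.
Qed.

Lemma continuous_cutoff' d : continuous (cutoff' d).
Proof.
move=> s.
have c0 : {for s, continuous (fun t : R => t / d - 1)}.
  apply: (@continuousB R R R (fun t => t / d) (cst 1)); last exact: cst_continuous.
  by apply: (@continuousM R R id (cst d^-1)); [exact: cvg_id|exact: cst_continuous].
have c1 : {for s, continuous (fun t : R => sqpos (t / d - 1))}.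
  apply: (@continuous_comp R R R (fun t => t / d - 1) sqpos) => //.
  apply: differentiable_continuous; apply/derivable1_diffP.
  by case: (is_derive_sqpos (s / d - 1)).
apply: (@continuousM R R (fun t => 2 * Num.max 0 (1 - sqpos (t / d - 1)))
  (fun t => (2 * Num.max 0 (t / d - 1)) * d^-1)).
  exact: (@continuous_comp R R R _ (fun s => 2 * Num.max 0 (1 - s)) s c1 (continuous_ramp' _)).
apply: (@continuousM R R (fun t => 2 * Num.max 0 (t / d - 1)) (cst d^-1)); last first.
  exact: cst_continuous.
exact: (@continuous_comp R R R _ (fun s => 2 * Num.max 0 s) s c0 (continuous_sqpos' _)).
Qed.

Lemma cutoff_itv d s : 0 <= cutoff d s <= 1.
Proof. by rewrite ramp_ge0 ?sqpos_ge0 ?ramp_le1. Qed.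

Lemma cutoff_eq0 d s : 0 < d -> s <= d -> cutoff d s = 0 /\ cutoff' d s = 0.
Proof.
move=> d0 sd; have h : s / d - 1 <= 0 by rewrite subr_le0 ler_pdivrMr ?mul1r.
have h0 : Num.max 0 (s / d - 1) = 0 by apply/max_idPl.
by rewrite /cutoff /cutoff' /sqpos h0 expr0n ramp0 mulr0 mul0r mulr0.
Qed.

Lemma cutoff_eq1 d s : 0 < d -> 2 * d <= s -> cutoff d s = 1.
Proof.
move=> d0 sd; apply: ramp_eq1.
have h : 1 <= s / d - 1 by rewrite lerBrDr ler_pdivlMr.
by rewrite /sqpos maxEle ifT ?(le_trans ler01)// exprn_ege1.
Qed.

(** With [a = s / d - 1], the product of [2 (1 - a^2)_+] and [2 a_+] is nonzero only for [a] in []0,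
    1[], where it is at most 4. This bound dictates the amplitude [d / 4] of the competitor. *)
Lemma cutoff'_itv d s : 0 < d -> 0 <= cutoff' d s <= 4 / d.
Proof.
move=> d0; rewrite /cutoff' mulrA; set a := s / d - 1.
suff /andP[h0 h4] : 0 <= 2 * Num.max 0 (1 - sqpos a) * (2 * Num.max 0 a) <= 4.
  apply/andP; split; first by apply: mulr_ge0 => //; rewrite invr_ge0 ltW.
  by rewrite ler_pM2r ?invr_gt0.
rewrite /sqpos !maxEle; case: (leP 0 a) => a0; last by rewrite !mulr0 lexx ler0n.
case: (leP 0 (1 - a ^+ 2)) => h; last by rewrite mulr0 mul0r lexx ler0n.
have a1 : a <= 1 by rewrite leNgt; apply/negP => a1; nra.
by apply/andP; split; nra.
Qed.

End cutoff.

(** * Classical gradients are weak gradients *)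

Section c1c.
Context {R : realType} {N : nat}.
Local Notation E := 'rV[R]_N.
Local Notation mu := (lebesgue_rV R N).
Implicit Types (f g phi psi : E -> R) (K U : set E).

Let mulfunE f g x : (f * g) x = f x * g x. Proof. by []. Qed.

Lemma compact_closed_rV K : compact K -> closed K.
Proof. by apply: compact_closed; exact: norm_hausdorff. Qed.

Lemma C1c_intro U K phi : (forall x, C1at phi x) -> compact K -> K `<=` U ->
  (forall x, ~ K x -> phi x = 0) -> C1c U phi.
Proof.
move=> C cK KU phi0.
have sK : closure [set x | phi x != 0] `<=` K.
  rewrite [X in _ `<=` X](closure_id _).1; last exact: compact_closed_rV.
  apply: closure_subset => x /= /eqP phix; apply: contrapT => /phi0; exact: phix.
split.
- by move=> x; exact: C1at_differentiable.
- by move=> x; case: (C x).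
- by apply: subclosed_compact sK => //; exact: closed_closure.
- exact: subset_trans KU.
Qed.

Lemma C1c_C1at U phi x : C1c U phi -> C1at phi x.
Proof.
by case=> d c _ _; split; [exact: nbhs_forall|exact: c].
Qed.

Lemma C1c_support U phi : C1c U phi -> exists K,
  [/\ compact K, K `<=` U & forall x, ~ K x -> \forall y \near x, phi y = 0].
Proof.
case=> d c cK KU; exists (closure [set x | phi x != 0]); split => // x xK.
have : open (~` closure [set x | phi x != 0]) by rewrite openC; exact: closed_closure.
rewrite openE => /(_ _ xK); apply: (@filterS _ _ (nbhs_filter x)) => y /= yK.
apply: contrapT => phiy; apply: yK; apply: subset_closure; exact/eqP.
Qed.

(** [f] is controlled on [U] only; off the support of [psi] the product vanishes locally and both
    sides of the product rule are 0. *)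
Lemma C1cM U f psi : open U -> (forall x, U x -> C1at f x) -> C1c U psi ->
  C1c U (f * psi) /\
  forall x, grad (f * psi) x = f x *: grad psi x + psi x *: grad f x.
Proof.
move=> oU Cf Cp; have [K [cK KU K0]] := C1c_support _ _ Cp.
have near0 x : ~ K x -> \forall y \near x, cst 0 y = (f * psi) y.
  move=> /K0; apply: (@filterS _ _ (nbhs_filter x)) => y psi0.
  by rewrite mulfunE psi0 mulr0.
split.
  apply: (@C1c_intro _ K) => // [x|x /K0 /nbhs_singleton psi0]; last first.
    by rewrite mulfunE psi0 mulr0.
  have [Kx|/near0 h] := pselect (K x).
    by apply: C1atM; [exact/Cf/KU|exact: C1c_C1at Cp].
  exact: near_eq_C1at h (C1at_cst 0 x).
move=> x; have [Kx|xK] := pselect (K x).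
  apply: gradM; apply: C1at_differentiable; [exact/Cf/KU|exact: C1c_C1at Cp].
have g0 : grad (cst 0) x = 0 :> E by apply/rowP => i; rewrite !mxE derive_cst.
rewrite -(near_eq_grad _ _ _ (near0 _ xK)) g0 (nbhs_singleton (K0 _ xK)) scale0r addr0.
by rewrite (near_eq_grad _ (cst 0) _ (K0 _ xK)) g0 scaler0.
Qed.

Lemma continuous_on_loc_integrable U f : open U -> {in U, continuous f} ->
  loc_integrable U f.
Proof.
move=> oU cf; split; first exact: continuous_measurable_rV.
move=> K cK KU; have [C hC] : exists C, forall x, K x -> `|f x| <= C.
  apply: continuous_compact_bounded => // x; rewrite inE => Kx.
  by apply: cf; rewrite inE; exact: KU.
apply: measurable_bounded_integrable; first exact: compact_measurable_rV.
- exact: compact_lty.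
- apply: (measurable_funS _ KU); first exact: open_measurable_rV.
  exact: continuous_measurable_rV.
- by exists C; split; [exact: num_real|move=> r Cr x Kx; exact: le_trans (hC x Kx) (ltW Cr)].
Qed.

Lemma patch_support (T : Type) (V : pointedType) (K U : set T) (g : T -> V) :
  K `<=` U -> (forall x, ~ K x -> g x = point) -> g \_ U = g \_ K.
Proof.
move=> KU g0; apply/funext => x; rewrite !patchE.
have [Kx|xK] := pselect (K x); first by rewrite !mem_set//; exact: KU.
by rewrite [in RHS]memNset// g0//; case: ifP.
Qed.

Lemma integrable_support U K g : measurable U -> compact K -> K `<=` U ->
  (forall x, ~ K x -> g x = 0) -> mu.-integrable K (EFin \o g) ->
  mu.-integrable U (EFin \o g).
Proof.
move=> mU cK KU g0; have mK := compact_measurable_rV _ cK.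
rewrite (integrable_mkcond _ mU) (integrable_mkcond _ mK).
by rewrite (@patch_support _ _ K U)// => x /g0 /= ->.
Qed.

Lemma Rintegral_support U K g : K `<=` U -> (forall x, ~ K x -> g x = 0) ->
  \int[mu]_(x in U) g x = \int[mu]_x g x.
Proof.
move=> KU g0; rewrite Rintegral_mkcond (@patch_support _ _ K U)//.
by rewrite -(@patch_support _ _ K setT)// -Rintegral_mkcond.
Qed.

Lemma integral_grad_eq0 U psi i : C1c U psi -> \int[mu]_x grad psi x 0 i = 0.
Proof.
move=> Cp; have [K [cK KU K0]] := C1c_support _ _ Cp.
have [M M0 KM] := bounded_set_cube _ _ (compact_bounded cK).
rewrite /Rintegral (_ : (fun x => (grad psi x 0 i)%:E) =
    (fun x => ('D_(delta_mx 0 i) psi x)%:E)); last first.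
  by apply/funext => x; rewrite mxE.
rewrite (@integral_partial_eq0 _ _ i psi M)//.
- by move=> x; apply: diff_derivable; exact: C1at_differentiable (C1c_C1at _ _ x Cp).
- move=> x; rewrite (_ : 'D__ _ = fun y => grad psi y 0 i); last by apply/funext => y; rewrite mxE.
  by apply: continuous_coord; case: Cp => _ + _ _; exact.
- by move=> x xM; apply: nbhs_singleton (K0 _ _) => Kx; exact/xM/KM.
Qed.

Lemma C1at_grad_continuous f x i : C1at f x ->
  {for x, continuous (fun y => grad f y 0 i)}.
Proof. by case=> _ c; exact: continuous_coord. Qed.

(** The partial derivatives of [f * psi], a compactly supported C^1 function, integrate to 0; the
    product rule splits this integral into the two required ones. *)
Lemma C1_is_weak_gradient U f : open U -> (forall x, U x -> C1at f x) ->
  is_weak_gradient U f (grad f).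
Proof.
move=> oU Cf; have mU := open_measurable_rV _ oU.
have lf : loc_integrable U f.
  by apply: continuous_on_loc_integrable => // x; rewrite inE => Ux; exact/C1at_continuous/Cf.
have lg i : loc_integrable U (fun x => grad f x 0 i).
  apply: continuous_on_loc_integrable => // x; rewrite inE => Ux.
  exact/C1at_grad_continuous/Cf.
split => // psi Cp i.
have [K [cK KU K0]] := C1c_support _ _ Cp.
have mK := compact_measurable_rV _ cK.
have [Cfp gfp] := C1cM _ _ _ oU Cf Cp.
have psi0 x : ~ K x -> psi x = 0 by move=> /K0 /nbhs_singleton.
have gpsi0 x : ~ K x -> grad psi x 0 i = 0.
  by move=> /K0 h; rewrite (near_eq_grad _ (cst 0) _ h) mxE derive_cst.
have i1 : mu.-integrable U (EFin \o (fun x => f x * grad psi x 0 i)).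
  apply: (@integrable_support _ K) => // [x /gpsi0 ->|]; first by rewrite mulr0.
  apply: (continuous_on_loc_integrable U _ oU _).2 => // x; rewrite inE => Ux.
  apply: (@continuousM R E f (fun x => grad psi x 0 i)); first exact/C1at_continuous/Cf.
  exact: C1at_grad_continuous (C1c_C1at _ _ x Cp).
have i2 : mu.-integrable U (EFin \o (fun x => grad f x 0 i * psi x)).
  apply: (@integrable_support _ K) => // [x /psi0 ->|]; first by rewrite mulr0.
  apply: (continuous_on_loc_integrable U _ oU _).2 => // x; rewrite inE => Ux.
  apply: (@continuousM R E (fun x => grad f x 0 i) psi); first exact/C1at_grad_continuous/Cf.
  exact: C1at_continuous (C1c_C1at _ _ x Cp).
apply/eqP; rewrite -subr_eq0 opprK -RintegralD//; apply/eqP.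
rewrite -(@integral_grad_eq0 _ (f * psi) i Cfp).
rewrite (@Rintegral_support U K)// => [|x xK].
  apply: eq_Rintegral => x _.
  by rewrite gfp [RHS]mxE [X in _ = X + _]mxE [X in _ = _ + X]mxE [X in _ + X = _]mulrC.
by rewrite gpsi0// psi0// !mulr0 addr0.
Qed.

End c1c.

(** * The fundamental lemma of the calculus of variations *)

Section fundamental_lemma.
Context {R : realType} {N : nat}.
Local Notation E := 'rV[R]_N.
Local Notation mu := (lebesgue_rV R N).
Implicit Types (f g phi psi : E -> R) (K U : set E).

(** The bump is [(1 - |y - x|^2 / r^2)_+^2]. Outside the closed box of half-side [r] about [x] a
    single coordinate already forces [|y - x| >= r], so the bump is 0 there. *)
Lemma C1_bump (x : E) U : nbhs x U -> exists (b : E -> R) K,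
  [/\ forall y, C1at b y, compact K /\ K `<=` U,
      forall y, ~ K y -> b y = 0, forall y, 0 <= b y <= 1 & b x = 1].
Proof.
move=> /nbhs_ballP[e /= e0 eU]; pose r := e / 2.
have r0 : 0 < r by rewrite divr_gt0.
pose s : E -> R := \sum_(i < N)
  ((fun y : E => y 0 i) + cst (- x 0 i)) * ((fun y : E => y 0 i) + cst (- x 0 i)).
have sE y : s y = \sum_(i < N) (y 0 i - x 0 i) ^+ 2.
  by rewrite /s fct_sumE; apply: eq_bigr => i _; rewrite expr2.
pose b : E -> R := sqpos \o (cst 1 + cst (- r ^- 2) * s).
have bE y : b y = sqpos (1 - s y / r ^+ 2).
  by rewrite /b /=; congr sqpos; rewrite -[LHS]/(1 + (- r ^- 2) * s y) mulNr mulrC.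
have s0 y : 0 <= s y by rewrite sE sumr_ge0// => i _; exact: sqr_ge0.
exists b, [set y | forall i, `[x 0 i - r, x 0 i + r]%classic (y 0 i)]; split.
- move=> y; apply: (C1at_comp sqpos (fun s => 2 * Num.max 0 s)).
  + exact: is_derive_sqpos.
  + exact: continuous_sqpos'.
  + apply: C1atD; first exact: C1at_cst.
    apply: C1atM; first exact: C1at_cst.
    apply: C1at_sum => i.
    by apply: C1atM; apply: C1atD; first [exact: C1at_coord|exact: C1at_cst].
- split.
    apply: (@rV_compact R _ (fun i => `[x 0 i - r, x 0 i + r]%classic)) => i.
    exact: segment_compact.
  move=> y hy; apply: eU; split => // i j; rewrite ord1 /ball/=.
  have := hy j; rewrite /= in_itv/= -ler_distl distrC => h.
  by rewrite (le_lt_trans h)// ltr_pdivrMr// ltr_pMr// ltr1n.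
- move=> y /= /existsNP[i hi]; rewrite bE.
  have {}hi : r < `|y 0 i - x 0 i|.
    by rewrite ltNge; apply/negP => h; apply: hi; rewrite in_itv/= -ler_distl.
  have : r ^+ 2 <= s y.
    rewrite sE (bigD1 i)//= -[X in X <= _]addr0 lerD ?sumr_ge0//; last first.
      by move=> j _; exact: sqr_ge0.
    by rewrite -[X in _ <= X]real_normK ?num_real// lerXn2r ?nnegrE ?normr_ge0 ?ltW.
  move=> h; have : 1 - s y / r ^+ 2 <= 0 by rewrite subr_le0 ler_pdivlMr ?exprn_gt0// mul1r.
  by move=> /max_idPl; rewrite /sqpos => ->; rewrite expr0n.
- move=> y; rewrite bE sqpos_ge0/= /sqpos.
  have := divr_ge0 (s0 y) (sqr_ge0 r); set q := _ / _ => q0.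
  rewrite maxEle; case: (leP 0 (1 - q)) => h; last by rewrite expr0n ler01.
  by rewrite expr_le1//; lra.
- rewrite bE sE big1 ?mul0r ?subr0.
    by rewrite /sqpos maxEle ler01 expr1n.
  by move=> i _; rewrite subrr expr0n.
Qed.

(* A pi-system generating the Borel sets whose members are limits of test      *)
(* functions: [ramp (n S b)] tends to the indicator of [{S > 0} & {b > 0}].    *)
Definition C1_pos_set : set (set E) :=
  [set A | exists S : E -> R, [/\ forall x, C1at S x, forall x, 0 <= S x & A = [set x | 0 < S x]]].

Lemma C1_pos_setI : setI_closed C1_pos_set.
Proof.
move=> _ _ [S [CS S0 ->]] [S' [CS' S'0 ->]]; exists (S * S'); split.
- by move=> x; exact: C1atM.
- by move=> x; exact: mulr_ge0.
- apply/seteqP; split => x /=; rewrite -[(S * S') x]/(S x * S' x).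
    by move=> [? ?]; exact: mulr_gt0.
  move=> h; split; rewrite lt_neqAle ?S0 ?S'0 andbT; apply/eqP => h0.
    by move: h; rewrite -h0 mul0r ltxx.
  by move: h; rewrite -h0 mulr0 ltxx.
Qed.

Lemma C1_pos_setT : C1_pos_set [set: E].
Proof.
exists (cst 1); split; [by move=> x; exact: C1at_cst|by move=> x; exact: ler01|].
by apply/seteqP; split => x _ //=; exact: ltr01.
Qed.

Lemma C1_pos_set_measurable : C1_pos_set `<=` measurable.
Proof.
move=> _ [S [CS _ ->]]; apply: open_measurable_rV.
apply: (@open_comp _ _ S [set t | 0 < t]); last exact: open_gt.
by move=> x _; exact: C1at_continuous.
Qed.

(** The half-space [{y_i > a}] is the positivity set of [sqpos (y_i - a)], and half-spaces generate
    the sigma-algebra of the coordinates. *)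
Lemma measurable_C1_pos_set : @measurable _ E = <<s C1_pos_set >>.
Proof.
apply/seteqP; split; last first.
  apply: smallest_sub; first exact: sigma_algebra_measurable.
  exact: C1_pos_set_measurable.
pose T : measurableType _ := g_sigma_algebraType C1_pos_set.
have mid : measurable_fun [set: T] (id : T -> E).
  apply: measurable_fun_rV => i.
  apply: (measurability _ (RGenOInfty.measurableE R)) => _ [_ [a ->] <-].
  rewrite setTI; apply: sub_sigma_algebra.
  exists (sqpos \o ((fun y : E => y 0 i) + cst (- a))); split.
  - move=> y; apply: (C1at_comp sqpos (fun s => 2 * Num.max 0 s)).
    + exact: is_derive_sqpos.
    + exact: continuous_sqpos'.
    + by apply: C1atD; [exact: C1at_coord|exact: C1at_cst].
  - by move=> y; exact: sqpos_ge0.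
  - by apply/seteqP; split => y /=; rewrite in_itv/= andbT sqpos_gt0 subr_gt0.
move=> A mA; have := mid measurableT A mA; rewrite setTI; exact.
Qed.

Lemma ramp_cvg (s : R) : 0 <= s ->
  (fun n : nat => ramp (n%:R * s)) @ \oo --> ((0 < s)%R%:R : R).
Proof.
rewrite le_eqVlt => /predU1P[<-|s0].
  rewrite ltxx (_ : (fun n => _) = cst 0); first exact: cvg_cst.
  by apply/funext => n /=; rewrite mulr0 ramp0.
rewrite s0; apply: cvg_near_cst; near=> n; apply: ramp_eq1.
rewrite -ler_pdivrMr// div1r; near: n; exact: nbhs_infty_ger.
Unshelve. all: by end_near. Qed.

(** Dominated convergence, with bound [|h|], gives a zero integral of [h] over each
    [{S > 0} & {b > 0}]. Dynkin's theorem extends this to all Borel subsets of [{b > 0}], which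
    forces [h] to vanish there almost everywhere. *)
Lemma ae_eq0_of_C1_test (h b : E -> R) :
  mu.-integrable [set: E] (EFin \o h) -> (forall x, C1at b x) -> (forall x, 0 <= b x) ->
  (forall (S : E -> R) (n : nat), (forall x, C1at S x) -> (forall x, 0 <= S x) ->
     (\int[mu]_x (h x * ramp (n%:R * (S x * b x)))%:E = 0)%E) ->
  {ae mu, forall x, 0 < b x -> h x = 0}.
Proof.
move=> ih Cb b0 H.
have mh : measurable_fun [set: E] h by have /measurable_int/measurable_EFinP := ih.
pose V := [set x | 0 < b x].
have mV : measurable V.
  by apply: C1_pos_set_measurable; exists b.
have ihV : mu.-integrable [set: E] ((EFin \o h) \_ V).
  exact/(integrable_mkcond _ mV)/(integrableS measurableT mV (@subsetT _ _) ih).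
have zeroG A : C1_pos_set A -> (\int[mu]_(x in A) ((EFin \o h) \_ V) x = 0)%E.
  move=> GA; have mA := C1_pos_set_measurable _ GA; move: GA => [S [CS S0 AE]].
  rewrite integral_mkcond -patch_setI.
  have mS : measurable_fun [set: E] (fun x => S x * b x).
    apply: continuous_measurable_rV => [|x _]; first exact: openT.
    by apply: (@continuousM R E S b); exact: C1at_continuous.
  have mf n : measurable_fun [set: E] (fun x => (h x * ramp (n%:R * (S x * b x)))%:E).
    apply/measurable_EFinP/measurable_funM => //.
    apply: (@measurableT_comp _ _ _ _ _ _ (fun t : R => ramp (n%:R * t))) => //.
    apply: continuous_measurable_fun => t.
    apply: (@continuous_comp R R R (fun t => n%:R * t) ramp); first exact: mulrl_continuous.
    apply: differentiable_continuous; apply/derivable1_diffP.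
    by case: (is_derive_ramp (n%:R * t)).
  have SbE x : ((EFin \o h) \_ (A `&` V)) x = (h x * (0 < S x * b x)%R%:R)%:E.
    rewrite patchE; case: ifPn => [|xAV].
      by rewrite inE AE => -[/= Sx Vx]; rewrite mulr_gt0// mulr1.
    rewrite (_ : S x * b x = 0) ?ltxx ?mulr0//; apply: contrapT => /eqP.
    rewrite mulf_eq0 negb_or => /andP[Sx bx]; move/negP: xAV; apply.
    by rewrite inE AE; split; rewrite /V /= lt_neqAle eq_sym ?Sx ?bx ?S0 ?b0.
  have mlim : measurable_fun [set: E] ((EFin \o h) \_ (A `&` V)).
    apply/(measurable_restrict _ (measurableI _ _ mA mV) measurableT).
    by apply: measurable_funTS; exact/measurable_EFinP.
  have clim : {ae mu, forall x, [set: E] x ->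
      (h x * ramp (n%:R * (S x * b x)))%:E @[n --> \oo] --> ((EFin \o h) \_ (A `&` V)) x}.
    apply: aeW => x _; rewrite SbE; apply: cvg_EFin; first by apply: nearW.
    apply: (@cvgM R nat \oo _ (cst (h x)) (fun n : nat => ramp (n%:R * (S x * b x)))).
      exact: cvg_cst.
    by apply: ramp_cvg; exact: mulr_ge0.
  have dom : {ae mu, forall x n, [set: E] x ->
      (`|(h x * ramp (n%:R * (S x * b x)))%:E| <= (abse \o (EFin \o h)) x)%E}.
    apply: aeW => x n _; rewrite /= lee_fin normrM ler_piMr// ger0_norm ?ramp_le1//.
    by rewrite ramp_ge0// !mulr_ge0.
  have [_ _] := dominated_convergence measurableT mf mlim clim (integrable_abse ih) dom.
  rewrite (_ : [sequence _]_n = cst 0%E); last first.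
    by apply/funext => n /=; exact: H.
  by move=> /cvg_lim <- //; rewrite lim_cst.
have zero A : measurable A -> (\int[mu]_(x in A) ((EFin \o h) \_ V) x = 0)%E.
  rewrite measurable_C1_pos_set.
  apply: (dynkin_induction measurable_C1_pos_set C1_pos_setI
    (P := fun A => (\int[mu]_(x in A) ((EFin \o h) \_ V) x = 0)%E)).
  - exact: zeroG C1_pos_setT.
  - exact: zeroG.
  (* The whole space belongs to the pi-system and has integral 0, hence so does the complement of
     [S]. *)
  - move=> S mS S0; have mC := measurableC mS.
    have : (\int[mu]_(x in S `|` ~` S) ((EFin \o h) \_ V) x = 0)%E.
      by rewrite setUCr; exact: zeroG C1_pos_setT.
    rewrite integral_setU//.
    + by rewrite S0 add0e.
    + by rewrite setUCr; exact: measurable_int ihV.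
    + by apply/disj_setPS; rewrite setICr.
  - move=> F mF tF F0; rewrite integral_bigcup//.
      by rewrite eseries0.
    by apply: (integrableS measurableT _ (@subsetT _ _) ihV); exact: bigcup_measurable.
have : ae_eq mu setT ((EFin \o h) \_ V) (cst 0%E).
  apply: integral_ae_eq => // A _ mA.
  by rewrite zero// integral0.
apply: (@filterS _ _ (ae_filter_ringOfSetsType mu)) => x /= + Vx; rewrite patchE mem_set// => h0.
by have := h0 I => -[].
Qed.

(** A Lindelof argument: each point of [U] lies in some [rat_ball n] on which [P] holds almost
    everywhere, and the countably many exceptional sets have a negligible union. *)
Lemma ae_local U (P : E -> Prop) :
  (forall x, U x -> exists2 V, nbhs x V & {ae mu, forall y, V y -> P y}) ->
  {ae mu, forall x, U x -> P x}.
Proof.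
move=> h; pose G := [set n | {ae mu, forall y, rat_ball n y -> P y}].
pose F n := if pselect (G n) is left _ then rat_ball n `&` [set y | ~ P y] else set0.
have nF n : mu.-negligible (F n).
  rewrite /F; case: pselect => [Gn|_]; last exact: negligible_set0.
  by apply: negligibleS Gn => y /= [ry Py] /(_ ry).
apply: negligibleS (negligible_bigcup nF) => x /= /not_implyP[Ux Px].
have [V xV aeV] := h x Ux; have [n [nx nV]] := nbhs_rat_ball _ _ xV.
exists n => //; rewrite /F; case: pselect => [_ //|nG]; exfalso; apply: nG.
by apply: (@filterS _ _ (ae_filter_ringOfSetsType mu)) aeV => y /= VP /nV.
Qed.

(** Localization by a bump [b] at each point of [U]: restricted to the compact set [K] the function
    [h] is integrable, and [ramp (n S b)] vanishes off [K] whatever [S] is, so it is an admissible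
    test function. *)
Lemma loc_integrable_eq0_ae U (h : E -> R) : open U -> loc_integrable U h ->
  (forall psi, C1c U psi -> \int[mu]_(x in U) (h x * psi x) = 0) ->
  {ae mu, forall x, U x -> h x = 0}.
Proof.
move=> oU [mh ih] H; apply: ae_local => x Ux.
have [|b [K [Cb [cK KU] bK b01 bx]]] := @C1_bump x U.
  by move: oU; rewrite openE => /(_ x Ux).
have mK := compact_measurable_rV _ cK.
have bpos : open [set y | 0 < b y].
  apply: (@open_comp _ _ b [set t | 0 < t]); last exact: open_gt.
  by move=> y _; exact: C1at_continuous.
exists [set y | 0 < b y].
  by move: bpos; rewrite openE; apply; rewrite /= bx ltr01.
have hKE : EFin \o (h \_ K) = (EFin \o h) \_ K.
  by apply/funext => y; rewrite /= !patchE; case: ifP.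
have ihK : mu.-integrable [set: E] (EFin \o (h \_ K)).
  by rewrite hKE; apply/(integrable_mkcond _ mK); exact: ih.
have b0 y : 0 <= b y by case/andP: (b01 y).
have K0 y : 0 < b y -> K y by move=> by0; apply: contrapT => /bK h0; rewrite h0 ltxx in by0.
have key := ae_eq0_of_C1_test (h \_ K) b ihK Cb b0.
apply: (@filterS _ _ (ae_filter_ringOfSetsType mu)) (key _) => [y /= h0 by0|S n CS S0].
  by have := h0 by0; rewrite patchE mem_set//; exact: K0.
have Cpsi : C1c U (fun y => ramp (n%:R * (S y * b y))).
  apply: (@C1c_intro _ _ U K _ _ cK KU) => [y|y /bK ->]; last by rewrite !mulr0 ramp0.
  apply: (@C1at_comp _ _ ramp (fun s => 2 * Num.max 0 (1 - s)) (cst n%:R * (S * b))).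
  - exact: is_derive_ramp.
  - exact: continuous_ramp'.
  - by apply: C1atM; [exact: C1at_cst|exact: C1atM].
have hpsi y : h y * ramp (n%:R * (S y * b y)) = (h \_ K) y * ramp (n%:R * (S y * b y)).
  rewrite patchE; case: ifPn => // /negP yK.
  by rewrite (bK y) ?mulr0 ?ramp0 ?mulr0// => Ky; apply: yK; rewrite inE.
have := H _ Cpsi; rewrite (@Rintegral_support _ _ U K)//; last first.
  by move=> y /bK ->; rewrite !mulr0 ramp0 mulr0.
have ipsi : mu.-integrable [set: E] (EFin \o (fun y => (h \_ K) y * ramp (n%:R * (S y * b y)))).
  apply: (le_integrable measurableT _ _ ihK) => [|y _].
    apply/measurable_EFinP/measurable_funM.
      by have /measurable_int/measurable_EFinP := ihK.
    apply: continuous_measurable_rV => [|y _]; first exact: openT.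
    exact: C1at_continuous (C1c_C1at _ _ y Cpsi).
  rewrite /= lee_fin normrM ler_piMr// ger0_norm ?ramp_le1//.
  by rewrite ramp_ge0// !mulr_ge0.
under eq_Rintegral => y _ do rewrite hpsi.
(* The real-valued integral is [fine] of the extended one, so its being 0 yields the extended
   equality once finiteness is known. *)
move=> e; rewrite -(fineK (integrable_fin_num measurableT ipsi)).
by rewrite -[X in X = _]/((\int[mu]_y ((h \_ K) y * ramp (n%:R * (S y * b y))))%:E) e.
Qed.

Lemma weak_gradient_unique U f (g1 g2 : E -> E) : open U ->
  is_weak_gradient U f g1 -> is_weak_gradient U f g2 ->
  {ae mu, forall x, U x -> g1 x = g2 x}.
Proof.
move=> oU [lf lg1 h1] [_ lg2 h2].
have mU := open_measurable_rV _ oU.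
have hi i : {ae mu, forall x, U x -> g1 x 0 i - g2 x 0 i = 0}.
  apply: loc_integrable_eq0_ae => //.
    split; first by apply: measurable_funB; [exact: (lg1 i).1|exact: (lg2 i).1].
    move=> K cK KU.
    apply: (@integrableB _ _ _ mu K (compact_measurable_rV _ cK)
      (fun x => (g1 x 0 i)%:E) (fun x => (g2 x 0 i)%:E)).
      exact: (lg1 i).2.
    exact: (lg2 i).2.
  move=> psi Cp; have [K [cK KU K0]] := C1c_support _ _ Cp.
  have psi0 x : ~ K x -> psi x = 0 by move=> /K0 /nbhs_singleton.
  have int (g : E -> E) : loc_integrable U (fun x => g x 0 i) ->
      mu.-integrable U (EFin \o (fun x : E => g x 0 i * psi x)).
    move=> [mg ig]; have mK := compact_measurable_rV _ cK.
    apply: (@integrable_support _ _ U K) => // [x /psi0 ->|]; first by rewrite mulr0.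
    have [C hC] : exists C, forall x, K x -> `|psi x| <= C.
      by apply: continuous_compact_bounded => // x _; exact: C1at_continuous (C1c_C1at _ _ x Cp).
    have mp : measurable_fun [set: E] psi.
      apply: continuous_measurable_rV => [|y _]; first exact: openT.
      exact: C1at_continuous (C1c_C1at _ _ y Cp).
    apply: (@le_integrable _ _ _ mu K _ _ (EFin \o (fun x => `|C| * g x 0 i))) => //.
    - apply/measurable_EFinP/measurable_funM; last exact: measurable_funS mp.
      exact: (measurable_funS mU KU mg).
    - move=> x Kx; rewrite /= lee_fin !normrM mulrC ler_wpM2r//.
      by rewrite (le_trans (hC x Kx))// normr_id ler_norm.
    - by apply: (@integrableZl _ _ _ mu K mK `|C| (fun x => (g x 0 i)%:E)); exact: ig.
  under eq_Rintegral => x _ do rewrite mulrBl.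
  rewrite RintegralB//; [|exact: int..].
  by rewrite -[X in X - _]opprK -[X in _ - X]opprK -h1// -h2// subrr.
have : {ae mu, forall x, forall i, U x -> g1 x 0 i - g2 x 0 i = 0}.
  exact: (@filter_forall E 'I_N (fun i => [set x | U x -> g1 x 0 i - g2 x 0 i = 0]) _
    (ae_filter_ringOfSetsType mu)).
apply: (@filterS _ _ (ae_filter_ringOfSetsType mu)) => x /= h Ux.
by apply/rowP => i; apply/eqP; rewrite -subr_eq0; apply/eqP; exact: h.
Qed.

(** [xget] returns a weak gradient as soon as one exists, and [grad f] is one; uniqueness then
    compares the two. *)
Lemma wgrad_ae U f : open U -> (forall x, U x -> C1at f x) ->
  is_weak_gradient U f (wgrad U f) /\
  {ae mu, forall x, U x -> wgrad U f x = grad f x}.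
Proof.
move=> oU Cf; have h := C1_is_weak_gradient _ _ oU Cf.
have hw : is_weak_gradient U f (wgrad U f).
  by apply: (@xgetPex _ (fun=> 0) [set g | is_weak_gradient U f g]); exists (grad f).
by split => //; exact: weak_gradient_unique hw h.
Qed.

End fundamental_lemma.

(** * The Euclidean norm, and C^1 regularity from a Hoelder gradient *)

Section euclidean_norm.
Context {R : realType} {N : nat}.
Local Notation E := 'rV[R]_N.
Implicit Types x y : E.

Lemma edot_ge0 x : 0 <= edot x x.
Proof. by apply: sumr_ge0 => i _; rewrite -expr2 sqr_ge0. Qed.

Lemma enorm_ge0 x : 0 <= enorm x.
Proof. exact: sqrtr_ge0. Qed.

Lemma enorm_sqr x : enorm x ^+ 2 = edot x x.
Proof. by rewrite sqr_sqrtr// edot_ge0. Qed.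

Lemma edotDl x y z : edot (x + y) z = edot x z + edot y z.
Proof. by rewrite -big_split/=; apply: eq_bigr => i _; rewrite mxE mulrDl. Qed.

Lemma edotC x y : edot x y = edot y x.
Proof. by apply: eq_bigr => i _; rewrite mulrC. Qed.

Lemma edotZl a x y : edot (a *: x) y = a * edot x y.
Proof. by rewrite mulr_sumr; apply: eq_bigr => i _; rewrite mxE mulrA. Qed.

(** Cauchy-Schwarz, from [|a x - b y|^2 >= 0] with [a = |y|] and [b = |x|]. If one of the norms is
    0, a coefficient large enough on that vector contradicts [edot x y > 0]. *)
Lemma enorm_edot_le x y : edot x y <= enorm x * enorm y.
Proof.
have h a b : 0 <= a ^+ 2 * edot x x + b ^+ 2 * edot y y - 2 * a * b * edot x y.
  have := edot_ge0 (a *: x + (- b) *: y).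
  rewrite edotDl edotC edotDl [X in _ + X]edotC edotDl !edotZl.
  rewrite ![edot _ (_ *: _)]edotC !edotZl (edotC y x) => h; lra.
have [x0|x0] := eqVneq (enorm x) 0.
  have xx : edot x x = 0 by rewrite -enorm_sqr x0 expr0n.
  rewrite x0 mul0r leNgt; apply/negP => xy; have := h ((edot y y + 1) / edot x y) 1.
  rewrite xx mulr0 add0r expr1n mul1r mulr1 -mulrA divfK ?gt_eqF//.
  by have := edot_ge0 y; lra.
have [y0|y0] := eqVneq (enorm y) 0.
  have yy : edot y y = 0 by rewrite -enorm_sqr y0 expr0n.
  rewrite y0 mulr0 leNgt; apply/negP => xy; have := h 1 ((edot x x + 1) / edot x y).
  rewrite yy mulr0 addr0 expr1n mul1r mulr1 -mulrA divfK ?gt_eqF//.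
  by have := edot_ge0 x; lra.
have xp : 0 < enorm x by rewrite lt_neqAle eq_sym x0 enorm_ge0.
have yp : 0 < enorm y by rewrite lt_neqAle eq_sym y0 enorm_ge0.
have := h (enorm y) (enorm x); rewrite -!enorm_sqr => H.
have : 0 <= 2 * (enorm x * enorm y) * (enorm x * enorm y - edot x y) by lra.
by rewrite pmulr_rge0 ?subr_ge0// !mulr_gt0.
Qed.

Lemma enormD x y : enorm (x + y) <= enorm x + enorm y.
Proof.
rewrite -[leRHS]ger0_norm ?addr_ge0 ?enorm_ge0// -sqrtr_sqr ler_wsqrtr//.
rewrite edotDl edotC edotDl [X in _ + X]edotC edotDl -!enorm_sqr (edotC y x).
by have := enorm_edot_le x y; lra.
Qed.

Lemma enormZ a x : enorm (a *: x) = `|a| * enorm x.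
Proof.
by rewrite /enorm edotZl edotC edotZl mulrA -expr2 sqrtrM ?sqr_ge0// sqrtr_sqr.
Qed.

Lemma enormN x : enorm (- x) = enorm x.
Proof. by rewrite -scaleN1r enormZ normrN1 mul1r. Qed.

Lemma coord_le_enorm x i : `|x 0 i| <= enorm x.
Proof.
rewrite -sqrtr_sqr ler_wsqrtr// /edot (bigD1 i)//= -expr2 lerDl sumr_ge0// => j _.
by rewrite -expr2 sqr_ge0.
Qed.

Lemma continuous_enorm : continuous (@enorm R N).
Proof.
move=> x; apply: (@continuous_comp E R R (fun x => edot x x) Num.sqrt); last exact: sqrt_continuous.
rewrite (_ : (fun x => edot x x) = \sum_(i < N) ((fun x : E => x 0 i) * (fun x : E => x 0 i))).
  elim/big_ind : _ => [|f g|i _]; first exact: cst_continuous.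
    exact: (@continuousD R R E).
  by apply: (@continuousM R E); exact: coord_continuous.
by apply/funext => y; rewrite fct_sumE.
Qed.

Lemma measurable_enorm_powR d (T : measurableType d) (U : set T) (g : T -> E) p :
  measurable U -> (forall i, measurable_fun U (fun t => g t 0 i)) ->
  measurable_fun U (fun t => enorm (g t) `^ p).
Proof.
move=> mU mg.
have me : measurable_fun U (fun t => edot (g t) (g t)).
  by apply: measurable_sum => i; apply: measurable_funM.
have ms := measurableT_comp (continuous_measurable_fun (@sqrt_continuous R)) me.
exact: (measurableT_comp (measurable_powR p) ms).
Qed.

Lemma C1alpha_loc_C1at (U : set E) (f : E -> R) a : open U -> 0 < a ->
  C1alpha_loc a U f -> forall x, U x -> C1at f x.
Proof.
move=> oU a0 [df H] x Ux.
have Unx : nbhs x U by move: oU; rewrite openE => /(_ x Ux).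
split; first by apply: (@filterS _ _ (nbhs_filter x)) Unx => y /df.
move/nbhs_ballP : (Unx) => [e /= e0 eU].
pose K := [set y : E | forall i, `[x 0 i - e / 2, x 0 i + e / 2]%classic (y 0 i)].
have cK : compact K.
  apply: (@rV_compact R _ (fun i => `[x 0 i - e / 2, x 0 i + e / 2]%classic)) => i.
  exact: segment_compact.
have KE y : K y <-> forall i, `|y 0 i - x 0 i| <= e / 2.
  by split => h i; have := h i; rewrite /= in_itv/= -ler_distl.
have KU : K `<=` U.
  move=> y /KE hy; apply: eU; split => // i j; rewrite ord1 /ball/= distrC.
  by rewrite (le_lt_trans (hy j))// ltr_pdivrMr// ltr_pMr// ltr1n.
have Kx : K x by apply/KE => i; rewrite subrr normr0 divr_ge0// ltW.
have [C hC] := H K cK KU.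
have Kn : nbhs x K.
  have e2 : 0 < e / 2 by rewrite divr_gt0.
  apply: (@filterS _ _ (nbhs_filter x) _ _ _ (nbhsx_ballx x (e / 2) e2)) => y [_ xy].
  apply/KE => i; rewrite distrC ltW//; exact: xy.
apply: continuous_rV => i; apply: (proj2 (@cvgrPdist_lt _ _ _ _ (nbhs_filter x) _ _)) => d d0.
(* The Hoelder constant [C] comes without a sign; [C'] is positive, and the radius [s] solves
   [C' * s ^ a = d]. *)
pose C' := `|C| + 1.
have C'0 : 0 < C' by rewrite ltr_wpDl.
pose s := (d / C') `^ a^-1.
have s0 : 0 < s by apply: powR_gt0; rewrite divr_gt0.
have ns : \forall y \near x, enorm (y - x) < s.
  have c : {for x, continuous (fun y : E => enorm (y - x))}.
    apply: (@continuous_comp E E R (fun y => y - x) (@enorm R N)); last exact: continuous_enorm.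
    apply: continuous_rV => j.
    rewrite (_ : (fun _ => _) = (fun y : E => y 0 j) - cst (x 0 j)).
      by apply: (@continuousB R R E); [exact: coord_continuous|exact: cst_continuous].
    by apply/funext => y; rewrite !mxE.
  have := proj1 (@cvgrPdist_lt _ _ _ _ (nbhs_filter x) _ _) c s s0.
  apply: (@filterS _ _ (nbhs_filter x)) => y.
  have -> : enorm (x - x) = 0 by rewrite subrr -(scale0r (0 : E)) enormZ normr0 mul0r.
  by rewrite sub0r normrN ger0_norm ?enorm_ge0.
apply: (@filterS2 _ _ (nbhs_filter x) _ _ _ _ Kn ns) => y Ky ys.
have -> : grad f x 0 i - grad f y 0 i = (grad f x - grad f y) 0 i.
  by rewrite [RHS]mxE [X in _ = _ + X]mxE.
rewrite (le_lt_trans (coord_le_enorm _ _))// (le_lt_trans (hC _ _ Kx Ky))//.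
rewrite -enormN opprB.
have le1 : C * enorm (y - x) `^ a <= C' * enorm (y - x) `^ a.
  by rewrite ler_wpM2r ?powR_ge0// (le_trans (ler_norm C))// lerDl.
rewrite (le_lt_trans le1)// mulrC -ltr_pdivlMr//.
have -> : d / C' = s `^ a by rewrite -powRrM mulVf ?gt_eqF// powRr1// divr_ge0// ltW.
by rewrite gt0_ltr_powR// nnegrE ?enorm_ge0// ltW.
Qed.

End euclidean_norm.

(** * Minimality in terms of classical gradients *)

Section classical.
Context {R : realType} {N : nat}.
Local Notation E := 'rV[R]_N.
Local Notation mu := (lebesgue_rV R N).
Implicit Types (f g phi psi v : E -> R) (K U : set E).

Definition Jdens (p a b gamma : R) v (x : E) : R :=
  enorm (grad v x) `^ p / p + Fgamma a b gamma (v x).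

Lemma Fgamma_ge0 (a b gamma s : R) : 0 <= a -> 0 <= b -> 0 <= Fgamma a b gamma s.
Proof. by move=> a0 b0; rewrite addr_ge0// mulr_ge0// powR_ge0. Qed.

Lemma measurable_Fgamma (a b gamma : R) d (T : measurableType d) (U : set T) (h : T -> R) :
  measurable_fun U h -> measurable_fun U (fun x => Fgamma a b gamma (h x)).
Proof.
move=> mh.
have mp : measurable_fun U (fun x => Num.max (h x) 0 `^ gamma).
  by apply: (measurableT_comp (measurable_powR gamma)); exact: measurable_funrpos.
have mn : measurable_fun U (fun x => Num.max (- h x) 0 `^ gamma).
  by apply: (measurableT_comp (measurable_powR gamma)); exact: measurable_funrneg.
by apply: measurable_funD; apply: measurable_funM.
Qed.

Lemma measurable_Jdens p a b gamma U (h : E -> R) (g : E -> E) : measurable U ->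
  measurable_fun U h -> (forall i, measurable_fun U (fun x => g x 0 i)) ->
  measurable_fun U (fun x => (enorm (g x) `^ p / p + Fgamma a b gamma (h x))%:E).
Proof.
move=> mU mh mg; apply/measurable_EFinP; apply: measurable_funD.
  by apply: measurable_funM => //; exact: measurable_enorm_powR.
exact: measurable_Fgamma.
Qed.

Lemma C1_measurable U f : open U -> (forall x, U x -> C1at f x) ->
  measurable_fun U f /\ forall i, measurable_fun U (fun x => grad f x 0 i).
Proof.
move=> oU Cf; split=> [|i]; apply: continuous_measurable_rV => // x; rewrite inE => Ux.
  exact/C1at_continuous/Cf.
exact/C1at_grad_continuous/Cf.
Qed.

(** The integral does not see the null set on which [wgrad] and [grad] may differ. *)
Lemma J_classical U p a b gamma v : open U -> 0 < p -> 0 <= a -> 0 <= b ->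
  (forall x, U x -> C1at v x) ->
  J U p a b gamma v = (\int[mu]_(x in U) (Jdens p a b gamma v x)%:E)%E.
Proof.
move=> oU p0 a0 b0 Cv; have [[lv lg _] ae] := wgrad_ae _ _ oU Cv.
have [mv mg] := C1_measurable _ _ oU Cv.
apply: ge0_ae_eq_integral.
- exact: open_measurable_rV.
- apply: measurable_Jdens => // [|i]; first exact: open_measurable_rV.
  exact: (lg i).1.
- by apply: measurable_Jdens => //; exact: open_measurable_rV.
- by move=> x _; rewrite lee_fin addr_ge0 ?Fgamma_ge0// divr_ge0 ?powR_ge0 ?ltW.
- by move=> x _; rewrite lee_fin addr_ge0 ?Fgamma_ge0// divr_ge0 ?powR_ge0 ?ltW.
- apply: (@filterS _ _ (ae_filter_ringOfSetsType mu)) ae => x /= h Ux.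
  by rewrite h.
Qed.

Lemma bounded_integral_lty U f C : measurable U -> (mu U < +oo)%E ->
  measurable_fun U f -> (forall x, U x -> `|f x| <= C) ->
  (\int[mu]_(x in U) (f x)%:E < +oo)%E.
Proof.
move=> mU Uoo mf fC; have if_ : mu.-integrable U (EFin \o f).
  apply: measurable_bounded_integrable => //.
  by exists C; split; [exact: num_real|move=> r Cr x Ux; exact: le_trans (fC x Ux) (ltW Cr)].
by have := integrable_fin_num mU if_; rewrite fin_numE => /andP[_]; rewrite ltey.
Qed.

Lemma powR_mono (s t q : R) : 0 <= q -> 0 <= s -> s <= t -> s `^ q <= t `^ q.
Proof.
by move=> q0 s0 st; apply: ge0_ler_powR; rewrite ?nnegrE//; exact: le_trans st.
Qed.

(** The constant sequence [phi] approximates itself; its norms are finite because [phi] and its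
    gradient are bounded on the compact closure of [U]. *)
Lemma C1c_W1p0 p U phi : 0 < p -> open U -> compact (closure U) -> C1c U phi ->
  W1p0 p U phi.
Proof.
move=> p0 oU cU Cp; have mU := open_measurable_rV _ oU.
have Cphi x : U x -> C1at phi x by move=> _; exact: C1c_C1at Cp.
have [[lv lg hw] ae] := wgrad_ae _ _ oU Cphi.
have [mv mg] := C1_measurable _ _ oU Cphi.
have Uoo : (mu U < +oo)%E.
  apply: le_lt_trans (compact_lty _ _ cU); apply: le_measure; rewrite ?inE//.
    exact: compact_measurable_rV.
  exact: subset_closure.
have ee : (\int[mu]_(x in U) (enorm (grad phi x - wgrad U phi x) `^ p)%:E = 0)%E.
  rewrite (@ge0_ae_eq_integral _ _ _ mu U _ (cst 0%E))//.
  - by rewrite integral0.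
  - apply/measurable_EFinP/measurable_enorm_powR => // i.
    rewrite (_ : (fun _ => _) = (fun x => grad phi x 0 i - wgrad U phi x 0 i)).
      by apply: measurable_funB => //; exact: (lg i).1.
    by apply/funext => x; rewrite mxE [X in _ + X]mxE.
  - by move=> x _; rewrite lee_fin powR_ge0.
  - apply: (@filterS _ _ (ae_filter_ringOfSetsType mu)) ae => x /= h Ux.
    by rewrite h// subrr -(scale0r (0 : E)) enormZ normr0 mul0r powR0// gt_eqF.
split.
  split; first by exists (wgrad U phi).
    have [C hC] : exists C, forall x, closure U x -> `|phi x| <= C.
      by apply: continuous_compact_bounded => // x _; exact: C1at_continuous (C1c_C1at _ _ x Cp).
    apply: (@bounded_integral_lty _ _ (C `^ p)) => //.
      by apply: (measurableT_comp (measurable_powR p)); exact: measurableT_comp.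
    move=> x Ux; rewrite ger0_norm ?powR_ge0//; have h := hC x (subset_closure Ux).
    by apply: powR_mono => //; exact: ltW.
  rewrite (@ge0_ae_eq_integral _ _ _ mu U _ (fun x => (enorm (grad phi x) `^ p)%:E))//.
  - have [C hC] : exists C, forall x, closure U x -> `|enorm (grad phi x)| <= C.
      apply: continuous_compact_bounded => // x _.
      apply: (@continuous_comp E E R (grad phi) (@enorm R N)); last exact: continuous_enorm.
      by case: Cp => _ + _ _; exact.
    apply: (@bounded_integral_lty _ _ (C `^ p)) => //.
      exact: measurable_enorm_powR.
    move=> x Ux; rewrite ger0_norm ?powR_ge0//; have := hC x (subset_closure Ux).
    rewrite ger0_norm ?enorm_ge0// => h.
    by apply: powR_mono => //; [exact: ltW|exact: enorm_ge0].
  - by apply/measurable_EFinP/measurable_enorm_powR => // i; exact: (lg i).1.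
  - by apply/measurable_EFinP/measurable_enorm_powR.
  - by move=> x _; rewrite lee_fin powR_ge0.
  - by move=> x _; rewrite lee_fin powR_ge0.
  - by apply: (@filterS _ _ (ae_filter_ringOfSetsType mu)) ae => x /= h Ux; rewrite h.
exists (fun=> phi); split => //.
- rewrite (_ : (fun _ => _) = cst 0%E); first exact: cvg_cst.
  apply/funext => k; rewrite (eq_integral (cst 0%E)) ?integral0// => x _.
  by rewrite subrr normr0 powR0// gt_eqF.
- by rewrite ee; exact: cvg_cst.
Qed.

(** The form of minimality suited to the comparison argument: C^1 perturbations, classical
    gradients, and a finite energy that can be subtracted. *)
Definition classical_minimizer (U : set E) (p a b gamma : R) v : Prop :=
  [/\ forall x, U x -> C1at v x,
      (\int[mu]_(x in U) (Jdens p a b gamma v x)%:E < +oo)%E &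
      forall V phi, open V -> compactly_contained V U -> C1c V phi ->
        (\int[mu]_(x in U) (Jdens p a b gamma v x)%:E <=
         \int[mu]_(x in U) (Jdens p a b gamma (v + phi) x)%:E)%E].

Lemma powR_le1D (s g p : R) : 0 <= s -> 0 < g -> g <= p -> s `^ g <= 1 + s `^ p.
Proof.
move=> s0 g0 gp; have [s1|s1] := leP s 1.
  rewrite (@le_trans _ _ 1) ?lerDl ?powR_ge0//.
  have := powR_mono s 1 g (ltW g0) s0 s1; rewrite (_ : 1 `^ g = 1)//.
  by rewrite powR1.
by rewrite (@le_trans _ _ (s `^ p)) ?lerDr// ler_powR// ltW.
Qed.

(** As [gamma < 1 < p], the potential is at most [(a + b) (1 + |v|^p)], which is integrable on a
    bounded set. *)
Lemma J_lty U p a b gamma v : open U -> bounded_set U -> 1 < p -> 0 <= a -> 0 <= b ->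
  0 < gamma -> gamma < 1 -> W1p p U v -> (J U p a b gamma v < +oo)%E.
Proof.
move=> oU bU p1 a0 b0 g0 g1 [[g hg] vp gp]; have mU := open_measurable_rV _ oU.
have p0 : 0 < p by rewrite (lt_trans _ p1).
have [[mv _] lg _] : is_weak_gradient U v (wgrad U v).
  by apply: (@xgetPex _ (fun=> 0) [set g | is_weak_gradient U v g]); exists g.
have mvp : measurable_fun U (fun x => `|v x| `^ p).
  by apply: (measurableT_comp (measurable_powR p)); exact: measurableT_comp.
have mgp : measurable_fun U (fun x => enorm (wgrad U v x) `^ p).
  by apply: measurable_enorm_powR => // i; exact: (lg i).1.
have Uoo := bounded_set_lty _ _ mU bU.
pose c := a + b.
have c0 : 0 <= c by rewrite addr_ge0.
have mc : measurable_fun U (fun x => (c%:E * (`|v x| `^ p)%:E)%E).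
  by apply: emeasurable_funM => //; exact/measurable_EFinP.
have h : (\int[mu]_(x in U) ((enorm (wgrad U v x) `^ p)%:E +
    (c%:E + c%:E * (`|v x| `^ p)%:E)) < +oo)%E.
  rewrite ge0_integralD; [|exact: mU|by move=> x _; rewrite lee_fin powR_ge0
    |exact/measurable_EFinP
    |by move=> x _; rewrite -EFinM -EFinD lee_fin addr_ge0// mulr_ge0// powR_ge0
    |exact: emeasurable_funD (measurable_cst _) mc].
  rewrite ge0_integralD; [|exact: mU|by []|exact: measurable_cst
    |by move=> x _; rewrite -EFinM lee_fin mulr_ge0// powR_ge0|exact: mc].
  rewrite ge0_integralZl; [|exact: mU|exact/measurable_EFinP
    |by move=> x _; rewrite lee_fin powR_ge0|by rewrite lee_fin].
  rewrite integral_cst// lte_add_pinfty// lte_add_pinfty//.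
    exact: (lte_mul_pinfty _ _ Uoo).
  exact: (lte_mul_pinfty _ _ vp).
apply: le_lt_trans h; apply: ge0_le_integral => //.
- by move=> x _; rewrite lee_fin addr_ge0 ?Fgamma_ge0// divr_ge0 ?powR_ge0 ?ltW.
- by apply: measurable_Jdens => // i; exact: (lg i).1.
- apply: emeasurable_funD; first exact/measurable_EFinP.
  exact: emeasurable_funD (measurable_cst _) mc.
- move=> x _; rewrite lee_fin lerD//.
    by rewrite ler_pdivrMr// ler_peMr ?powR_ge0// ltW.
  have hs s : Num.max s 0 <= `|s| -> Num.max s 0 `^ gamma <= 1 + `|s| `^ p.
    move=> hs; apply: le_trans (_ : `|s| `^ gamma <= _).
      by apply: powR_mono => //; [exact: ltW|rewrite le_max lexx orbT].
    by rewrite powR_le1D// ltW// (lt_trans g1).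
  have h1 := hs (v x); have h2 := hs (- v x); rewrite normrN in h2.
  have {}h1 := h1 _; have {}h2 := h2 _.
  rewrite /Fgamma /c (_ : a + b + _ = a * (1 + `|v x| `^ p) + b * (1 + `|v x| `^ p)); last by ring.
  rewrite lerD// ler_wpM2l//.
    by apply: h1; rewrite ge_max ler_norm normr_ge0.
  by apply: h2; rewrite ge_max -normrN ler_norm normr_ge0.
Qed.

Lemma local_minimizer_classical U p a b gamma v : open U -> bounded_set U ->
  1 < p -> 0 <= a -> 0 <= b -> 0 < gamma -> gamma < 1 ->
  (forall x, U x -> C1at v x) -> local_minimizer U p a b gamma v ->
  classical_minimizer U p a b gamma v.
Proof.
move=> oU bU p1 a0 b0 g0 g1 Cv [Wv H]; have p0 : 0 < p by rewrite (lt_trans _ p1).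
split; first exact: Cv.
  by rewrite -(J_classical U p a b gamma v oU p0 a0 b0 Cv); exact: J_lty.
move=> V phi oV cV Cp.
have Cvp x : U x -> C1at (v + phi) x.
  by move=> Ux; apply: C1atD; [exact: Cv|exact: C1c_C1at Cp].
rewrite -(J_classical U p a b gamma v oU p0 a0 b0 Cv).
rewrite -(J_classical U p a b gamma _ oU p0 a0 b0 Cvp).
have := H V oV cV phi (C1c_W1p0 _ _ _ p0 oV cV.1 Cp).
suff -> : phi \_ V = phi by [].
have [K [_ KV K0]] := C1c_support _ _ Cp.
apply/funext => x; rewrite patchE; case: ifPn => // /negP xV.
by rewrite (nbhs_singleton (K0 x _))// => Kx; apply: xV; rewrite inE; exact: KV.
Qed.

Lemma gradN f x : differentiable f x -> grad (- f) x = - grad f x.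
Proof.
by move=> df; apply/rowP => i; rewrite !mxE deriveN//; exact: diff_derivable.
Qed.

(** Negation exchanges the positive and negative parts in [Fgamma] and keeps the norm of the
    gradient, so the estimate for [u^\-] follows from the one for [u^\+]. *)
Lemma classical_minimizerN U p a b gamma v : classical_minimizer U p a b gamma v ->
  classical_minimizer U p b a gamma (- v).
Proof.
move=> [Cv Joo H].
have JN f : (forall x, U x -> C1at f x) ->
    (\int[mu]_(x in U) (Jdens p b a gamma (- f) x)%:E =
     \int[mu]_(x in U) (Jdens p a b gamma f x)%:E)%E.
  move=> Cf; apply: eq_integral => x; rewrite inE => Ux; congr EFin.
  rewrite /Jdens gradN; last exact/C1at_differentiable/Cf.
  by rewrite enormN /Fgamma [in RHS](addrC (a * _)) -[(- f) x]/(- f x) opprK.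
split=> [x Ux||V phi oV cV Cp].
- exact/C1atN/Cv.
- by rewrite (JN v Cv).
have CNp : C1c V (- phi).
  rewrite (_ : - phi = cst (-1) * phi).
    exact: (C1cM V (cst (-1)) phi oV (fun x _ => C1at_cst (-1) x) Cp).1.
  by apply/funext => x; exact: (esym (mulN1r (phi x))).
rewrite (_ : - v + phi = - (v + - phi)); last by rewrite opprD opprK.
rewrite (JN v Cv) JN; last by move=> x Ux; apply: C1atD; [exact: Cv|exact: C1c_C1at CNp].
exact: H cV CNp.
Qed.

End classical.

(** * The competitor *)

Section powers.
Context {R : realType}.

(* Convexity along [al + t b = (1 - t) al + t (al + b)]. *)
Lemma powR_convex_le (p al b t : R) : 1 <= p -> 0 <= al -> 0 <= b -> 0 <= t <= 1 ->
  (al + t * b) `^ p <= al `^ p + t * (al + b) `^ p.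
Proof.
move=> p1 al0 b0 /andP[t0 t1].
have c := @convex_powR R p p1 (Itv01 t0 t1) (al + b) al.
have h1 : al + b \in (`[0, +oo[%classic : set R) by rewrite inE/= in_itv/= andbT addr_ge0.
have h2 : al \in (`[0, +oo[%classic : set R) by rewrite inE/= in_itv/= andbT.
have {c} : (t * (al + b) + (1 - t) * al) `^ p <= t * (al + b) `^ p + (1 - t) * al `^ p.
  exact: c h1 h2.
have -> : t * (al + b) + (1 - t) * al = al + t * b by ring.
move=> h; apply: le_trans h _; rewrite addrC lerD2r.
by rewrite ler_piMl ?powR_ge0// gerBl.
Qed.

(** The tangent bound of a concave power at [u]. Divided by [u ^ g] it becomes
    [v ^ g <= g v + (1 - g)] with [v = (u - s) / u], which is Young's inequality for [v ^ g] and 1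
    with exponents [1 / g] and [1 / (1 - g)]. *)
Lemma powR_bernoulli (g u s : R) : 0 < g -> g < 1 -> 0 < u -> 0 <= s -> s <= u ->
  (u - s) `^ g + g * u `^ (g - 1) * s <= u `^ g.
Proof.
move=> g0 g1 u0 s0 su; pose v := (u - s) / u.
have v0 : 0 <= v by apply: divr_ge0; [rewrite subr_ge0|exact: ltW].
have g1' : 0 < 1 - g by rewrite subr_gt0.
have hv : v `^ g <= g * v + (1 - g).
  have := @conjugate_powR R (v `^ g) 1 g^-1 (1 - g)^-1 (powR_ge0 _ _) ler01.
  rewrite !invr_gt0 !invrK => /(_ g0 g1').
  have -> : g + (1 - g) = 1 by ring.
  move=> /(_ erefl); rewrite mulr1 -powRrM divff ?gt_eqF// powRr1// powR1 mul1r.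
  by rewrite mulrC.
have us : u - s = v * u by rewrite divfK ?gt_eqF.
rewrite -[g * _ * s]mulrA; have -> : u `^ (g - 1) * s = u `^ g * (1 - v).
  have -> : s = u * (1 - v) by rewrite mulrBr mulr1 (mulrC u) -us; ring.
  by rewrite mulrA -[X in _ `^ _ * X * _](powRr1 (ltW u0)) -powRD ?subrK// gt_eqF ?implybT.
rewrite us powRM ?(ltW u0)//.
have up := powR_ge0 u g; nra.
Qed.

End powers.

Section core.
Context {R : realType} {N : nat}.
Local Notation E := 'rV[R]_N.
Local Notation mu := (lebesgue_rV R N).
Implicit Types (v eta : E -> R) (K U V : set E).

(* Since [0 <= cutoff' d <= 4 / d], the coefficient of [grad v] in the gradient *)
(* of the competitor [v + truncation d v eta] stays in [0, 1].                 *)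
Definition truncation (d : R) v eta : E -> R := (cst (- (d / 4)) * (cutoff d \o v)) * eta.

Lemma truncationE d v eta x :
  truncation d v eta x = - (d / 4 * cutoff d (v x) * eta x).
Proof. by rewrite -[LHS]/(- (d / 4) * cutoff d (v x) * eta x) !mulNr. Qed.

Lemma grad_truncation d v eta x : C1at v x -> C1at eta x ->
  grad (v + truncation d v eta) x =
  (1 - d / 4 * cutoff' d (v x) * eta x) *: grad v x
  + (- (d / 4 * cutoff d (v x))) *: grad eta x.
Proof.
move=> Cv Ce; have dv := C1at_differentiable _ _ Cv; have de := C1at_differentiable _ _ Ce.
have [dc gc] := grad_comp (cutoff d) (cutoff' d) v x (is_derive_cutoff d) dv.
have dk : differentiable (cst (- (d / 4)) : E -> R) x by exact: differentiable_cst.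
have df : differentiable (cst (- (d / 4)) * (cutoff d \o v)) x by exact: differentiableM.
have df' : differentiable ((cst (- (d / 4)) * (cutoff d \o v)) * eta) x.
  exact: differentiableM.
rewrite (gradD _ _ _ dv df') (gradM _ _ _ df de) (gradM _ _ _ dk dc) gc.
have -> : grad (cst (- (d / 4)) : E -> R) x = 0.
  by apply/rowP => i; rewrite !mxE derive_cst.
rewrite scaler0 addr0 -[(_ * _) x]/(- (d / 4) * cutoff d (v x)) -[cst _ x]/(- (d / 4)).
apply/rowP => i; rewrite !mxE; ring.
Qed.

(** Put [t = d / 4]. The gradient of the competitor has norm at most [|grad v| + t B], so convexity
    bounds the increase of its term by [t (A + B)^p / p]. Where [v <= d] the value is unchanged;
    where [v > d] the amount subtracted is at most [d], so the competitor stays nonnegative and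
    concavity of the power [gamma] gives the gain. *)
Lemma competitor_le p a b gamma v eta A B d x :
  1 < p -> 0 <= a -> 0 <= b -> 0 < gamma -> gamma < 1 -> 0 < d -> d <= 1 ->
  C1at v x -> C1at eta x -> 0 <= eta x <= 1 ->
  enorm (grad v x) <= A -> enorm (grad eta x) <= B ->
  Jdens p a b gamma (v + truncation d v eta) x
    + d / 4 * (a * gamma * v x `^ (gamma - 1) * cutoff d (v x) * eta x)
  <= Jdens p a b gamma v x + d / 4 * ((A + B) `^ p / p).
Proof.
move=> p1 a0 b0 g0 g1 d0 d1 Cv Ce /andP[e0 e1] hA hB.
have p0 : 0 < p by rewrite (lt_trans _ p1).
have [c'0 c'4] := andP (cutoff'_itv d (v x) d0); have [c0 c1] := andP (cutoff_itv d (v x)).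
set t := d / 4; have t0 : 0 < t by rewrite divr_gt0.
have t1 : t <= 1 by rewrite ler_pdivrMr// mul1r (le_trans d1)// ler1n.
have al0 := enorm_ge0 (grad v x); have be0 := enorm_ge0 (grad eta x).
have B0 : 0 <= B by exact: le_trans be0 hB.
have A0 : 0 <= A by exact: le_trans al0 hA.
have grad_le : enorm (grad (v + truncation d v eta) x) <= enorm (grad v x) + t * B.
  rewrite grad_truncation//; apply: le_trans (enormD _ _) _; rewrite !enormZ.
  have tc' : 0 <= d / 4 * cutoff' d (v x) * eta x <= 1.
    apply/andP; split.
      exact: mulr_ge0 (mulr_ge0 (ltW t0) c'0) e0.
    have h : d / 4 * cutoff' d (v x) <= 1.
      rewrite (le_trans (ler_wpM2l (ltW t0) c'4))// /t -mulrA (mulrA 4^-1) mulVf// mul1r.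
      by rewrite divff// gt_eqF.
    by rewrite -[leRHS]mulr1; apply: ler_pM => //; exact: mulr_ge0 (ltW t0) c'0.
  case/andP: tc' => h0 h1; apply: lerD.
    rewrite ger0_norm; last by rewrite subr_ge0.
    by apply: (ler_piMl al0); rewrite gerBl.
  have tc0 : 0 <= d / 4 * cutoff d (v x) := mulr_ge0 (ltW t0) c0.
  by rewrite normrN ger0_norm//; apply: ler_pM => //; rewrite ler_piMr// ltW.
have Jgrad : enorm (grad (v + truncation d v eta) x) `^ p / p <=
    enorm (grad v x) `^ p / p + t * ((A + B) `^ p / p).
  rewrite mulrA -mulrDl ler_pM2r ?invr_gt0//.
  apply: le_trans (powR_mono _ _ _ (ltW p0) (enorm_ge0 _) grad_le) _.
  apply: le_trans (powR_convex_le _ _ _ _ (ltW p1) al0 B0 _) _; first by rewrite (ltW t0).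
  rewrite lerD2l ler_wpM2l ?(ltW t0)//.
  by apply: powR_mono; [exact: ltW p0|exact: addr_ge0 al0 B0|rewrite lerD2r].
suff JF : Fgamma a b gamma (v x + truncation d v eta x)
    + t * (a * gamma * v x `^ (gamma - 1) * cutoff d (v x) * eta x) <= Fgamma a b gamma (v x).
  rewrite /Jdens -[(v + truncation d v eta) x]/(v x + truncation d v eta x).
  rewrite -[leLHS]addrA [leRHS]addrAC; exact: lerD Jgrad JF.
rewrite truncationE; have [vd|dv] := leP (v x) d.
  by rewrite (cutoff_eq0 d (v x) d0 vd).1 !(mulr0, mul0r) oppr0 !addr0.
have vx0 : 0 < v x by exact: lt_trans dv.
set s := t * cutoff d (v x) * eta x.
have s0 : 0 <= s := mulr_ge0 (mulr_ge0 (ltW t0) c0) e0.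
have sd : s <= d.
  have h1 : t * cutoff d (v x) <= t by rewrite ler_piMr// ltW.
  have h2 : s <= t by apply: le_trans h1; rewrite ler_piMr//; exact: mulr_ge0 (ltW t0) c0.
  by apply: le_trans h2 _; rewrite ler_pdivrMr// ler_peMr ?(ltW d0)// ler1n.
have sv : s <= v x by rewrite (le_trans sd)// ltW.
have Fp r : 0 <= r -> Fgamma a b gamma r = a * r `^ gamma.
  move=> r0; rewrite /Fgamma (max_idPl r0) (max_idPr _) ?oppr_le0//.
  by rewrite powR0 ?mulr0 ?addr0// gt_eqF.
rewrite !Fp ?subr_ge0// ?(ltW vx0)//.
have := powR_bernoulli _ _ _ g0 g1 vx0 s0 sv => /(ler_wpM2l a0).
have -> : t * (a * gamma * v x `^ (gamma - 1) * cutoff d (v x) * eta x) =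
    a * (gamma * v x `^ (gamma - 1) * s).
  by rewrite /s; move: (v x `^ _) (cutoff _ _) (eta x) => q1 q2 q3; ring.
by rewrite -mulrDr.
Qed.

End core.

(** * Measure of the level sets *)

Section level_sets.
Context {R : realType} {N : nat}.
Local Notation E := 'rV[R]_N.
Local Notation mu := (lebesgue_rV R N).
Implicit Types (v eta : E -> R) (K U V : set E).

(** Integrate the pointwise inequality, bound the integral of [g] below by that of [f], and cancel
    the latter, which is finite. Here [f] and [g] stand for the energy densities of the minimizer
    and of the competitor. *)
Lemma integral_excess U (f g : E -> R) (S K : set E) (c1 c2 : R) :
  measurable U -> measurable S -> measurable K -> S `<=` U -> K `<=` U ->
  measurable_fun U f -> measurable_fun U g ->
  (forall x, U x -> 0 <= f x) -> (forall x, U x -> 0 <= g x) -> 0 <= c1 -> 0 <= c2 ->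
  (mu K < +oo)%E -> (\int[mu]_(x in U) (f x)%:E < +oo)%E ->
  (\int[mu]_(x in U) (f x)%:E <= \int[mu]_(x in U) (g x)%:E)%E ->
  (forall x, U x -> g x + c1 * \1_S x <= f x + c2 * \1_K x) ->
  (c1%:E * mu S <= c2%:E * mu K)%E.
Proof.
move=> mU mS mK SU KU mf mg f0 g0 c10 c20 Koo foo fg gf.
have mind (A : set E) (c : R) : measurable A -> measurable_fun U (fun x => (c%:E * (\1_A x)%:E)%E).
  by move=> mA; apply: emeasurable_funM => //; apply/measurable_EFinP; exact: measurable_indic.
have ind0 (A : set E) (c : R) x : 0 <= c -> (0 <= c%:E * (\1_A x)%:E :> \bar R)%E.
  by move=> c0; rewrite -EFinM lee_fin mulr_ge0.
have intD (h : E -> R) (A : set E) (c : R) : measurable_fun U h -> (forall x, U x -> 0 <= h x) ->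
    measurable A -> A `<=` U -> 0 <= c ->
    (\int[mu]_(x in U) ((h x)%:E + c%:E * (\1_A x)%:E) =
     \int[mu]_(x in U) (h x)%:E + c%:E * mu A)%E.
  move=> mh h0 mA AU c0; rewrite ge0_integralD; [|exact: mU
    |by move=> x Ux; rewrite lee_fin; exact: h0|exact/measurable_EFinP
    |by move=> x _; exact: ind0|exact: mind].
  rewrite ge0_integralZl; [|exact: mU|by apply/measurable_EFinP; exact: measurable_indic
    |by move=> x _; rewrite lee_fin|by rewrite lee_fin].
  by rewrite integral_indic// setIidl.
have : (\int[mu]_(x in U) (g x)%:E + c1%:E * mu S <=
        \int[mu]_(x in U) (f x)%:E + c2%:E * mu K)%E.
  rewrite -intD// -intD//; apply: ge0_le_integral; first exact: mU.
  - by move=> x Ux; rewrite adde_ge0 ?ind0// lee_fin; exact: g0.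
  - by apply: emeasurable_funD; [exact/measurable_EFinP|exact: mind].
  - by apply: emeasurable_funD; [exact/measurable_EFinP|exact: mind].
  - by move=> x Ux; rewrite -!EFinM -!EFinD lee_fin; exact: gf.
have ffin : (\int[mu]_(x in U) (f x)%:E)%E \is a fin_num.
  by rewrite ge0_fin_numE//; apply: integral_ge0 => x Ux; rewrite lee_fin; exact: f0.
by move=> /(le_trans (leeD2r _ fg)); rewrite leeD2lE.
Qed.

(** The bump [eta], and with it [V] and [C], is fixed before [eps]. Comparison with the truncation
    at [d = 1 / (n + 1)] bounds the measure of [S n] independently of [n], and the sets [S n]
    increase to the level set inside [V]. *)
Lemma level_set_local U p a b gamma v x0 : open U -> 1 < p -> 0 < a -> 0 <= b ->
  0 < gamma -> gamma < 1 -> classical_minimizer U p a b gamma v -> U x0 ->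
  exists V C, [/\ open V, V x0, 0 <= C &
    forall eps, 0 < eps ->
      (mu ([set x | (0 < v x <= eps)%R] `&` U `&` V) <= (C * eps `^ (1 - gamma))%:E)%E].
Proof.
move=> oU p1 a0 b0 g0 g1 [Cv Joo Hmin] Ux0; have p0 : 0 < p by rewrite (lt_trans _ p1).
have mU := open_measurable_rV _ oU.
(* Two nested bumps: the positivity set [V1] of the first is the open set, compactly contained in
   [U], that minimality asks for; the second, [eta], is supported in [V1]. *)
have [|b1 [K1 [Cb1 [cK1 K1U] b1K b101 b1x]]] := @C1_bump R N x0 U.
  by move: oU; rewrite openE => /(_ x0 Ux0).
have opos (f : E -> R) r : (forall x, C1at f x) -> open [set x | r < f x].
  move=> Cf; apply: (@open_comp _ _ f [set t | r < t]); last exact: open_gt.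
  by move=> x _; exact: C1at_continuous.
pose V1 := [set x | 0 < b1 x].
have oV1 : open V1 by exact: opos.
have V1K1 : closure V1 `<=` K1.
  rewrite [X in _ `<=` X](closure_id _).1; last exact: compact_closed_rV.
  apply: closure_subset => x /=; rewrite /V1 /= => h.
  by apply: contrapT => /b1K h0; rewrite h0 ltxx in h.
have cV1 : compactly_contained V1 U.
  split; last exact: subset_trans V1K1 K1U.
  exact: (subclosed_compact (@closed_closure _ _) cK1 V1K1).
have [|eta [K [Ce [cK KV1] eK e01 ex]]] := @C1_bump R N x0 V1.
  by move: oV1; rewrite openE; apply; rewrite /V1 /= b1x ltr01.
have V1U : V1 `<=` U by apply: subset_trans cV1.2; exact: subset_closure.
have KU : K `<=` U by exact: subset_trans KV1 V1U.
have mK := compact_measurable_rV _ cK.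
have Cp : C1c V1 eta := C1c_intro V1 K eta Ce cK KV1 eK.
have [A hA] : exists A, forall x, K x -> `|enorm (grad v x)| <= A.
  apply: continuous_compact_bounded => // x; rewrite inE => Kx.
  apply: (@continuous_comp E E R (grad v) (@enorm R N)); last exact: continuous_enorm.
  by case: (Cv x (KU _ Kx)).
have [B hB] : exists B, forall x, K x -> `|enorm (grad eta x)| <= B.
  apply: continuous_compact_bounded => // x _.
  apply: (@continuous_comp E E R (grad eta) (@enorm R N)); last exact: continuous_enorm.
  by case: (Ce x).
pose c2 := (A + B) `^ p / p.
have c20 : 0 <= c2 by rewrite divr_ge0 ?powR_ge0// ltW.
have Koo := compact_lty _ _ cK.
pose m := fine (mu K).
have mE : mu K = m%:E by rewrite /m fineK// ge0_fin_numE.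
have m0 : 0 <= m by rewrite /m fine_ge0.
have ag : 0 < a * gamma by rewrite mulr_gt0.
(* The cost [d / 4 * c2 * m] divided by the gain [c1] per unit of measure, without its power of
   [eps]; the 4 comes from [eta > 1 / 4]. *)
pose C := 4 * c2 * m / (a * gamma).
exists [set x | 1 / 4 < eta x], C; split.
- exact: opos.
- by rewrite /= ex ltr_pdivrMr// mul1r ltr1n.
- exact: divr_ge0 (mulr_ge0 (mulr_ge0 (ler0n _ _) c20) m0) (ltW ag).
move=> eps eps0.
have [mv mgv] := C1_measurable _ _ oU Cv.
pose S n := (U `&` v @^-1` `[2 * n.+1%:R^-1, eps]%classic) `&` [set x | 1 / 4 < eta x].
have mS n : measurable (S n).
  by apply: measurableI; [exact: mv|exact: open_measurable_rV (opos eta (1 / 4) Ce)].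
have SU n : S n `<=` U by move=> x [[]].
have Sn n : (mu (S n) <= (C * eps `^ (1 - gamma))%:E)%E.
  pose d : R := n.+1%:R^-1.
  have d0 : 0 < d by rewrite invr_gt0.
  have d1 : d <= 1 by rewrite invf_le1// ler1n.
  pose w := truncation d v eta.
  have Cw : C1c V1 w.
    apply: (C1cM V1 (cst (- (d / 4)) * (cutoff d \o v)) eta oV1 _ Cp).1 => x /V1U Ux.
    apply: C1atM; first exact: C1at_cst.
    exact: (C1at_comp _ _ _ _ (is_derive_cutoff d) (continuous_cutoff' d) (Cv x Ux)).
  have Cvw x : U x -> C1at (v + w) x.
    by move=> Ux; apply: C1atD; [exact: Cv|exact: C1c_C1at Cw].
  have [mvw mgvw] := C1_measurable _ _ oU Cvw.
  have J0 f x : 0 <= Jdens p a b gamma f x.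
    by rewrite addr_ge0 ?Fgamma_ge0 ?(ltW a0)// divr_ge0 ?powR_ge0// ltW.
  have t0 : 0 < d / 4 by rewrite divr_gt0.
  (* On [S n] the cutoff is 1 since [2 d <= v], [eta] exceeds [1 / 4], and [v <= eps] gives
     [v ^ (gamma - 1) >= eps ^ (gamma - 1)] because the exponent is negative. *)
  pose c1 := d / 4 * (a * gamma * eps `^ (gamma - 1) / 4).
  have c10 : 0 < c1.
    by rewrite mulr_gt0// divr_gt0// mulr_gt0//; apply: powR_gt0.
  have mJ f : measurable_fun U f -> (forall i, measurable_fun U (fun x => grad f x 0 i)) ->
      measurable_fun U (Jdens p a b gamma f).
    by move=> mf mgf; apply/measurable_EFinP; exact: measurable_Jdens.
  have : (c1%:E * mu (S n) <= (d / 4 * c2)%:E * mu K)%E.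
    apply: (integral_excess U (Jdens p a b gamma v) (Jdens p a b gamma (v + w))).
    - exact: mU.
    - exact: mS.
    - exact: mK.
    - exact: SU.
    - exact: KU.
    - exact: (mJ v mv mgv).
    - exact: (mJ _ mvw mgvw).
    - by move=> x _; exact: J0.
    - by move=> x _; exact: J0.
    - exact: ltW c10.
    - exact: mulr_ge0 (ltW t0) c20.
    - exact: Koo.
    - exact: Joo.
    - exact: (Hmin V1 w oV1 cV1 Cw).
    (* Off [K] the bump [eta] vanishes: the competitor agrees with [v] near [x], and [x] is not in
       [S n]. *)
    move=> x Ux; have [Kx|xK] := pselect (K x); last first.
      have -> : \1_(S n) x = 0 :> R.
        rewrite indicE memNset// => -[_ /=]; rewrite (eK x xK) ltNge; move/negP; apply.
        by rewrite divr_ge0.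
      rewrite mulr0 addr0.
      have -> : Jdens p a b gamma (v + w) x = Jdens p a b gamma v x.
        have nK : \forall y \near x, (v + w) y = v y.
          have : open (~` K) by rewrite openC; exact: compact_closed_rV.
          rewrite openE => /(_ x xK).
          apply: (@filterS _ _ (nbhs_filter x)) => y /= yK.
          by rewrite -[LHS]/(v y + truncation d v eta y) truncationE (eK y yK) mulr0 oppr0 addr0.
        by rewrite /Jdens (near_eq_grad _ _ _ nK) (nbhs_singleton nK).
      by rewrite lerDl mulr_ge0// mulr_ge0// ltW.
    have e01x := e01 x; have /andP[ex0 ex1] := e01x.
    have hc := competitor_le p a b gamma v eta A B d x p1 (ltW a0) b0 g0 g1 d0 d1
      (Cv x Ux) (Ce x) e01x (le_trans (ler_norm _) (hA x Kx)) (le_trans (ler_norm _) (hB x Kx)).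
    have -> : \1_K x = 1 :> R by rewrite indicE mem_set.
    rewrite mulr1; apply: le_trans hc; rewrite lerD2l.
    have P0 : 0 <= a * gamma * v x `^ (gamma - 1) * cutoff d (v x).
      have /andP[ct0 _] := cutoff_itv d (v x).
      exact: mulr_ge0 (mulr_ge0 (ltW ag) (powR_ge0 _ _)) ct0.
    have [Sx|xS] := pselect (S n x); last first.
      by rewrite indicE memNset// mulr0; exact: mulr_ge0 (ltW t0) (mulr_ge0 P0 ex0).
    rewrite indicE mem_set// mulr1 /c1 ler_pM2l//.
    case: Sx => -[_ /=]; rewrite in_itv/= => /andP[dv ve] eta4.
    rewrite (cutoff_eq1 d (v x) d0 dv) mulr1; apply: ler_pM.
    - exact: mulr_ge0 (ltW ag) (powR_ge0 _ _).
    - by rewrite invr_ge0.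
    - rewrite ler_pM2l//.
      have v0 : 0 < v x by apply: lt_le_trans dv; rewrite mulr_gt0.
      have -> : gamma - 1 = - (1 - gamma) by ring.
      rewrite !powRN lef_pV2 ?posrE; [|exact: powR_gt0..].
      by apply: powR_mono => //; [rewrite subr_ge0 ltW|exact: ltW].
    - by move: eta4; rewrite div1r => /ltW.
  rewrite mE -EFinM.
  have -> : (d / 4 * c2 * m)%:E = (c1%:E * (C * eps `^ (1 - gamma))%:E)%E.
    rewrite -EFinM; congr EFin; rewrite /c1 /C.
    have -> : gamma - 1 = - (1 - gamma) by ring.
    rewrite powRN; have : eps `^ (1 - gamma) != 0 by rewrite gt_eqF//; exact: powR_gt0.
    move: (eps `^ _) => q q0; field.
    by rewrite q0 !gt_eqF.
  by rewrite lee_pmul2l// ?lte_fin// fin_numE.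
have -> : [set x | (0 < v x <= eps)%R] `&` U `&` [set x | 1 / 4 < eta x] = \bigcup_n S n.
  apply/seteqP; split => [x [[/= /andP[v0 ve] Ux] ex4]|x [n _ [[Ux /=]]]]; last first.
    rewrite in_itv/= => /andP[dv ve] ex4; split => //; split => //=.
    by rewrite ve andbT; apply: lt_le_trans dv; rewrite mulr_gt0// invr_gt0.
  have v2 : 0 < v x / 2 by rewrite divr_gt0.
  have [//|k hk] := @ltr_add_invr R 0 (v x / 2) _; rewrite add0r in hk.
  exists k => //; split => //; split => //=; rewrite in_itv/= ve andbT.
  by rewrite mulrC -ler_pdivlMr// ltW.
(* Continuity of the measure along an increasing sequence carries the uniform bound over to the
   union. *)
have cvS : mu \o S @ \oo --> mu (\bigcup_n S n).
  apply: nondecreasing_cvg_mu => //; first exact: bigcup_measurable.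
  move=> i j ij; apply/subsetPset => x [[Ux /=]]; rewrite in_itv/= => /andP[iv ve] ex4.
  split => //; split => //=; rewrite in_itv/= ve andbT; apply: le_trans iv.
  by rewrite ler_pM2l// lef_pV2 ?posrE// ler_nat.
rewrite -(cvg_lim _ cvS)//; apply: lime_le; first exact: cvgP cvS.
by apply: nearW => n; exact: Sn.
Qed.

End level_sets.

(** * Level sets on a compact set *)

Section level_sets_compact.
Context {R : realType} {N : nat}.
Local Notation E := 'rV[R]_N.
Local Notation mu := (lebesgue_rV R N).
Implicit Types (v : E -> R) (K U : set E).

(** Finitely many of the neighbourhoods from [level_set_local] cover [K], and their constants add
    up; the extra 1 makes the sum positive. *)
Lemma level_set_compact U K p a b gamma v : open U -> compact K -> K `<=` U ->
  1 < p -> 0 < a -> 0 <= b -> 0 < gamma -> gamma < 1 ->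
  classical_minimizer U p a b gamma v ->
  exists2 C, 0 < C & forall eps (Q : set E), 0 < eps -> open Q -> Q `<=` K ->
    (mu ([set x | (0 < v x <= eps)%R] `&` Q) <= (C * eps `^ (1 - gamma))%:E)%E.
Proof.
move=> oU cK KU p1 a0 b0 g0 g1 Hmin.
have [Cv _ _] := Hmin; have [mv _] := C1_measurable _ _ oU Cv.
pose L eps := [set x | (0 < v x <= eps)%R].
have mL eps : measurable (L eps `&` U).
  rewrite (_ : L eps `&` U = U `&` v @^-1` `]0, eps]%classic).
    exact: mv (open_measurable_rV _ oU) _ (measurable_itv _).
  by rewrite setIC; apply/seteqP; split => x [Ux /=]; rewrite in_itv.
have : forall x, exists VC : set E * R, U x -> [/\ open VC.1, VC.1 x, 0 <= VC.2 &
    forall eps, 0 < eps -> (mu (L eps `&` U `&` VC.1) <= (VC.2 * eps `^ (1 - gamma))%:E)%E].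
  (* A dummy pair outside [U], since [choice] ranges over all points. *)
  move=> x; have [Ux|nUx] := pselect (U x); last by exists (set0, 0).
  have [V [C h]] := level_set_local U p a b gamma v x oU p1 a0 b0 g0 g1 Hmin Ux.
  by exists (V, C).
move=> /choice[VC hVC].
have : cover_compact K by rewrite -compact_cover.
move=> /(_ E K (fun x => (VC x).1)) [x /KU /hVC []//|x Kx|D DK KD].
  by exists x => //; have [] := hVC x (KU x Kx).
have DU x : x \in finmap.enum_fset D -> U x.
  by move=> /DK; rewrite inE => /KU.
exists (1 + \sum_(x <- finmap.enum_fset D) (VC x).2) => [|eps Q eps0 oQ QK].
  by rewrite ltr_wpDr// big_seq sumr_ge0// => x /DU /hVC [].
have bound (s : seq E) : (forall x, x \in s -> U x) ->
    (mu (L eps `&` U `&` \big[setU/set0]_(x <- s) (VC x).1) <=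
      (\sum_(x <- s) (VC x).2 * eps `^ (1 - gamma))%:E)%E.
  elim: s => [|x s IH] sU; first by rewrite !big_nil setI0 measure0.
  rewrite !big_cons setIUr EFinD.
  have [oV _ _ hV] := hVC x (sU x (mem_head _ _)).
  have mB : measurable (\big[setU/set0]_(x <- s) (VC x).1).
    rewrite big_seq; apply: bigsetU_measurable => y ys; apply: open_measurable_rV.
    by have [] := hVC y (sU y _); rewrite // inE ys orbT.
  apply: le_trans (measureU2 _ _ _) _.
  - by apply: measurableI => //; exact: open_measurable_rV.
  - exact: measurableI.
  - apply: leeD; first exact: hV.
    by apply: IH => y ys; apply: sU; rewrite inE ys orbT.
have mQ := open_measurable_rV _ oQ.
apply: (@le_trans _ _ (mu (L eps `&` U `&` \big[setU/set0]_(x <- finmap.enum_fset D) (VC x).1))).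
  apply: le_measure; rewrite ?inE.
  - rewrite (_ : _ `&` Q = (L eps `&` U) `&` Q); first exact: measurableI.
    by rewrite -setIA (setIidr (subset_trans QK KU)).
  - apply: measurableI => //; rewrite big_seq; apply: bigsetU_measurable => y /DU /hVC [oV _ _ _].
    exact: open_measurable_rV.
  - move=> x [Lx Qx]; have Kx := QK x Qx; split; first by split => //; exact: KU.
    by have [y Dy Vy] := KD x Kx; rewrite -bigcup_seq; exists y.
apply: le_trans (bound _ DU) _; rewrite lee_fin -mulr_suml ler_wpM2r ?powR_ge0//.
by rewrite lerDr.
Qed.

End level_sets_compact.

(** * The estimate at scale [r] *)

Theorem lemma5p2 (R : realType) (N : nat) (Omega : set 'rV[R]_N)
    (p lp lm gamma tau : R) (u : 'rV[R]_N -> R) :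
  (0 < N)%N ->
  open Omega -> bounded_set Omega -> lipschitz_boundary Omega ->
  1 < p -> 0 < lp -> 0 < lm ->
  0 < gamma ->
  gamma < Num.min 1 (p * alpha_p N p / (1 + alpha_p N p)) ->
  tau = gamma / (p - gamma) ->
  local_minimizer Omega p lp lm gamma u ->
  (exists2 alpha : R, 0 < alpha < 1 & C1alpha_loc alpha Omega u) ->
  forall Omega' : set 'rV[R]_N,
  open Omega' -> compactly_contained Omega' Omega ->
  forall C2 : R, growth_constant Omega tau u Omega' C2 ->
  (forall zp : 'rV[R]_N,
     (Gamma0 Omega u `&` boundary (positivity Omega u^\+)) zp ->
     exists2 C : R, 0 < C &
       forall r : R, 0 < r -> eball zp r `<=` Omega' ->
         (lebesgue_rV R N
            ([set x | (0 < u^\+ x <= C2 * r `^ (1 + tau))%R] `&` Omega')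
          <= (C * r `^ ((1 + tau) * (1 - gamma)))%:E)%E) /\
  (forall zm : 'rV[R]_N,
     (Gamma0 Omega u `&` boundary (positivity Omega u^\-)) zm ->
     exists2 C : R, 0 < C &
       forall r : R, 0 < r -> eball zm r `<=` Omega' ->
         (lebesgue_rV R N
            ([set x | (0 < u^\- x <= C2 * r `^ (1 + tau))%R] `&` Omega')
          <= (C * r `^ ((1 + tau) * (1 - gamma)))%:E)%E).
Proof.
move=> _ oO bO _ p1 lp0 lm0 g0 + _ mO [alpha /andP[alpha0 _] Hu] Omega' oO' [cO' sO'] C2 [C20 _].
rewrite lt_min => /andP[g1 _].
have Cu := C1alpha_loc_C1at Omega u alpha oO alpha0 Hu.
have Hp := local_minimizer_classical Omega p lp lm gamma u oO bO p1 (ltW lp0) (ltW lm0) g0 g1 Cu mO.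
have Hm := classical_minimizerN Omega p lp lm gamma u Hp.
(* One estimate for both signs, at the level [eps = C2 * r ^ (1 + tau)]. Its power [1 - gamma] is
   [C2 ^ (1 - gamma)], absorbed into the constant, times the required power of [r]. *)
have scale (w w' : 'rV[R]_N -> R) a b : 0 < a -> 0 < b -> (forall x, w' x = Num.max (w x) 0) ->
    classical_minimizer Omega p a b gamma w ->
    exists2 C : R, 0 < C & forall r : R, 0 < r ->
      (lebesgue_rV R N ([set x | (0 < w' x <= C2 * r `^ (1 + tau))%R] `&` Omega')
        <= (C * r `^ ((1 + tau) * (1 - gamma)))%:E)%E.
  move=> a0 b0 w'E Hw.
  have [C C0 hC] := level_set_compact Omega _ p a b gamma w oO cO' sO' p1 a0 (ltW b0) g0 g1 Hw.
  exists (C * C2 `^ (1 - gamma)) => [|r r0]; first by rewrite mulr_gt0// powR_gt0.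
  have e0 : 0 < C2 * r `^ (1 + tau) by rewrite mulr_gt0// powR_gt0.
  have := hC _ Omega' e0 oO' (@subset_closure _ _).
  rewrite powRM ?powR_ge0 ?(ltW C20)// -powRrM mulrA.
  rewrite (_ : [set x | (0 < w' x <= _)%R] = [set x | (0 < w x <= C2 * r `^ (1 + tau))%R])//.
  apply/seteqP; split => x /=; rewrite w'E lt_max ltxx orbF => /andP[w0 we]; rewrite w0/=.
    by rewrite (max_idPl (ltW w0)) in we.
  by rewrite (max_idPl (ltW w0)).
split=> [zp _|zm _].
- have [|C C0 hC] := scale u (u^\+) lp lm lp0 lm0 _ Hp; first by [].
  by exists C => // r r0 _; exact: hC.
(* The negative part of [u] is the positive part of [- u], which minimizes with [lm] and [lp]
   exchanged. *)
- have [|C C0 hC] := scale (- u) (u^\-) lm lp lm0 lp0 _ Hm; first by [].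
  by exists C => // r r0 _; exact: hC.
Qed.
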